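(* Let $f:\mathbb{R}^n\to\mathbb{R}^n$ be a continuous mapping and let $Jf:\mathbb{R}^n\rightrightarrows\mathcal{L}(\mathbb{R}^n,\mathbb{R}^n)$ be a pseudo-Jacobian map of $f$. Suppose that $Jf$ is upper semicontinuous at every point of $\mathbb{R}^n$ and that $f$ is $Jf$-regular on $\mathbb{R}^n$, i.e. $\alpha_{Jf}(x)>0$ for every $x\in\mathbb{R}^n$. Then the following conditions are equivalent: (a) $f:\mathbb{R}^n\to\mathbb{R}^n$ is a global homeomorphism (a homeomorphism of $\mathbb{R}^n$ onto $\mathbb{R}^n$). (b) For each compact subset $K\subset\mathbb{R}^n$ there exists $\alpha_K>0$ such that $\alpha_{Jf}(x)>\alpha_K$ for every $x\in f^{-1}(K)$.
   Context: $\mathbb{R}^n$ carries the Euclidean norm, with open unit ball $\mathbf{B}_n$; $\mathcal{L}(\mathbb{R}^n,\mathbb{R}^n)$ is the space of linear maps ($n\times n$ matrices) with the usual operator norm, with open unit ball $\mathbf{B}_{n\times n}$; $co$ denotes convex hull. Pseudo-Jacobian: for $f:\mathbb{R}^n\to\mathbb{R}^n$ continuous, a nonempty closed set $Jf(x)\subset\mathcal{L}(\mathbb{R}^n,\mathbb{R}^n)$ is a pseudo-Jacobian of $f$ at $x$ if for all $u,v\in\mathbb{R}^n$, $(vf)^+(x;u)\le\sup_{M\in Jf(x)}\langle v,Mu\rangle$ (in the extended reals), where $(vf)(y)=\sum_{i=1}^n v_if_i(y)$ and $(vf)^+(x;u)=\limsup_{t\to0^+}\frac{(vf)(x+tu)-(vf)(x)}{t}$.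 A set-valued map $Jf:x\mapsto Jf(x)$ is a pseudo-Jacobian map of $f$ if $Jf(x)$ is a pseudo-Jacobian of $f$ at $x$ for every $x\in\mathbb{R}^n$. For a set $S\subset\mathbb{R}^n$, $Jf(S)=\bigcup_{x\in S}Jf(x)$. Upper semicontinuity: $Jf$ is upper semicontinuous at $x$ if for every $\varepsilon>0$ there is $\delta>0$ with $Jf(x+\delta\mathbf{B}_n)\subseteq Jf(x)+\varepsilon\mathbf{B}_{n\times n}$. Regularity index: the co-norm of a matrix $A$ is $/\!/A/\!/=\inf_{\|u\|=1}\|Au\|$, and $\alpha_{Jf}(x)=\inf\{/\!/A/\!/ : A\in co(Jf(x))\}$. *)

(* Defs.v *)
From HB Require Import structures.
From mathcomp Require Import all_boot all_order all_algebra.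
From mathcomp Require Import all_classical all_reals all_analysis.

Set Implicit Arguments.
Unset Strict Implicit.
Unset Printing Implicit Defensive.

Import Order.TTheory GRing.Theory Num.Theory.
Import numFieldNormedType.Exports.

Local Open Scope classical_set_scope.
Local Open Scope ring_scope.

(* Points of R^n are column vectors, and linear maps are n x n matrices acting
   by [M *m u]. The library's own norm on matrices is the sup norm, so the
   Euclidean and operator norms are defined here. The ambient topology used for
   [closed], [compact] and [continuous] is the library's entrywise topology,
   which is the one induced by these norms. *)

Section Norms.
Variables (R : realType) (n : nat).
Implicit Types (u v : 'cV[R]_n) (A : 'M[R]_n).

Definition dotp u v : R := \sum_(i < n) u i 0 * v i 0.

Definition enorm u : R := Num.sqrt (\sum_(i < n) u i 0 ^+ 2).

Definition unit_ball : set 'cV[R]_n := [set u | enorm u < 1].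

Definition opnorm A : R :=
  sup [set enorm (A *m u) | u in [set u | enorm u <= 1]].

Definition op_unit_ball : set 'M[R]_n := [set A | opnorm A < 1].

(* Extended-real valued, so that the infimum over the empty unit sphere of R^0
   is +oo; for n > 0 the value is a nonnegative real. *)
Definition conorm A : \bar R :=
  ereal_inf [set (enorm (A *m u))%:E | u in [set u | enorm u = 1]].

Definition convex_hull (S : set 'M[R]_n) : set 'M[R]_n :=
  smallest (@convex_set R 'M[R]_n) S.

End Norms.

Section PseudoJacobian.
Variables (R : realType) (n : nat).
Implicit Types (f : 'cV[R]_n -> 'cV[R]_n) (x u v : 'cV[R]_n).
Implicit Types (S : set 'M[R]_n) (Jf : 'cV[R]_n -> set 'M[R]_n).

Definition upper_dini (phi : 'cV[R]_n -> R) x u : \bar R :=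
  limf_esup (fun t : R => ((phi (x + t *: u) - phi x) / t)%:E) 0^'+.

Definition pseudo_Jacobian f x S : Prop :=
  [/\ S !=set0, closed S &
    forall u v, (upper_dini (fun y => dotp v (f y)) x u <=
                 ereal_sup [set (dotp v (M *m u))%:E | M in S])%E].

Definition pseudo_Jacobian_map f Jf : Prop :=
  forall x, pseudo_Jacobian f x (Jf x).

Definition usc_at Jf x : Prop :=
  forall eps : R, 0 < eps -> exists2 delta : R, 0 < delta &
    \bigcup_(y in [set x + delta *: z | z in @unit_ball R n]) Jf y `<=`
    [set M + eps *: N | M in Jf x & N in @op_unit_ball R n].

Definition regularity_index Jf x : \bar R :=
  ereal_inf [set conorm A | A in convex_hull (Jf x)].

Definition global_homeomorphism f : Prop :=
  exists g : 'cV[R]_n -> 'cV[R]_n,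
    [/\ cancel f g, cancel g f, continuous f & continuous g].

End PseudoJacobian.

(* Main.v *)
(* From (b) to (a), near a point [x] all of [Jf] lies in a convex set [C] of
   matrices [A] with [a |u| <= |A u|], so Dini mean value estimates for the
   functions [<v, f>] put each increment [f (z + u) - f z] in the closure of [C u].
   Separating [C u] from a ball then gives [|f y - f z| >= a |y - z|] near [x].

   Openness of [f] needs no invariance of domain. The constraint on increments is
   convex, hence inherited by averages of translates of [f]; averaging along each
   coordinate axis gives a locally Lipschitz approximation, for which minimizing
   the distance to a target value over a ball solves the equation. Compactness
   passes the solutions to [f].

   By (b), the segments issued from [f 0] lift to Lipschitz paths issued from [0],
   so they lift up to time 1. Endpoints of lifts define a continuous right inverse
   [g] of [f]; the set where [g (f x) = x] is open, closed and contains [0], so [g]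
   is also a left inverse.

   From (a) to (b), the regularity index is bounded below near each point, hence on
   the compact image of [K] under the inverse. *)
Require Import Defs.
From HB Require Import structures.
From mathcomp Require Import all_boot all_order all_algebra.
From mathcomp Require Import all_classical all_reals all_analysis.
From mathcomp Require Import ring lra.
Import Order.TTheory GRing.Theory Num.Theory.
Import numFieldNormedType.Exports.
Local Open Scope classical_set_scope.
Local Open Scope ring_scope.

(** * Euclidean norm: inequalities, topology and compactness *)

Section EuclideanNorm.
Context {R : realType} {n : nat}.
Implicit Types (u v w x y z : 'cV[R]_n) (a e r : R).

Lemma dotpC u v : dotp u v = dotp v u.
Proof. by apply: eq_bigr => i _; rewrite mulrC. Qed.

Lemma dotpDr u v w : dotp u (v + w) = dotp u v + dotp u w.
Proof. by rewrite -big_split; apply: eq_bigr => i _; rewrite mxE mulrDr. Qed.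

Lemma dotpZr a u v : dotp u (a *: v) = a * dotp u v.
Proof. by rewrite mulr_sumr; apply: eq_bigr => i _; rewrite mxE mulrCA. Qed.

Lemma dotpNr u v : dotp u (- v) = - dotp u v.
Proof. by rewrite -scaleN1r dotpZr mulN1r. Qed.

Lemma dotpBr u v w : dotp u (v - w) = dotp u v - dotp u w.
Proof. by rewrite dotpDr dotpNr. Qed.

Lemma dotpDl u v w : dotp (v + w) u = dotp v u + dotp w u.
Proof. by rewrite dotpC dotpDr !(dotpC u). Qed.

Lemma dotpZl a u v : dotp (a *: u) v = a * dotp u v.
Proof. by rewrite dotpC dotpZr dotpC. Qed.

Lemma dotpNl u v : dotp (- u) v = - dotp u v.
Proof. by rewrite dotpC dotpNr dotpC. Qed.

Lemma dotpBl u v w : dotp (v - w) u = dotp v u - dotp w u.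
Proof. by rewrite dotpDl dotpNl. Qed.

Lemma dotp0r u : dotp u 0 = 0.
Proof. by rewrite -(scale0r 0) dotpZr mul0r. Qed.

Lemma dotp_mulmx (A : 'M[R]_n) u v : dotp u (A *m v) = dotp (A^T *m u) v.
Proof.
rewrite /dotp; under eq_bigr do rewrite mxE mulr_sumr.
under [RHS]eq_bigr do rewrite mxE mulr_suml.
rewrite exchange_big; apply: eq_bigr => i _; apply: eq_bigr => j _.
by rewrite mxE mulrCA mulrA.
Qed.

Lemma dotp_ge0 u : 0 <= dotp u u.
Proof. by apply: sumr_ge0 => i _; rewrite -expr2 sqr_ge0. Qed.

Lemma enorm_sqr u : enorm u ^+ 2 = dotp u u.
Proof. by rewrite sqr_sqrtr// sumr_ge0// => i _; exact: sqr_ge0. Qed.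

Lemma enorm_ge0 u : 0 <= enorm u.
Proof. exact: sqrtr_ge0. Qed.

Lemma enorm_coord u i : `|u i 0| <= enorm u.
Proof.
rewrite -sqrtr_sqr ler_wsqrtr// (bigD1 i)//= lerDl sumr_ge0// => j _.
exact: sqr_ge0.
Qed.

Lemma enorm0 : enorm (0 : 'cV[R]_n) = 0.
Proof. by rewrite /enorm big1 ?sqrtr0// => i _; rewrite mxE expr0n. Qed.

Lemma enorm_eq0 u : enorm u = 0 -> u = 0.
Proof.
move=> u0; apply/matrixP => i j; rewrite ord1 mxE; apply/eqP.
by rewrite -normr_le0 -u0 enorm_coord.
Qed.

Lemma enorm_gt0 u : u != 0 -> 0 < enorm u.
Proof.
by rewrite lt_def enorm_ge0 andbT; apply: contraNN => /eqP /enorm_eq0 ->.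
Qed.

Lemma enormZ a u : enorm (a *: u) = `|a| * enorm u.
Proof.
apply/eqP; rewrite -(@eqrXn2 _ 2)// ?mulr_ge0 ?enorm_ge0//.
by rewrite exprMn !enorm_sqr dotpZl dotpZr real_normK ?num_real// expr2 mulrA.
Qed.

Lemma enormN u : enorm (- u) = enorm u.
Proof. by rewrite -scaleN1r enormZ normrN1 mul1r. Qed.

Lemma enormBC u v : enorm (u - v) = enorm (v - u).
Proof. by rewrite -enormN opprB. Qed.

(** Cauchy-Schwarz: the vector [|u|^2 v - <u, v> u] has squared norm
    [|u|^2 (|u|^2 |v|^2 - <u, v>^2)]. *)
Lemma dotp_le u v : dotp u v <= enorm u * enorm v.
Proof.
have [->|u0] := eqVneq u 0; first by rewrite dotpC dotp0r enorm0 mul0r.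
have := dotp_ge0 (dotp u u *: v - dotp u v *: u).
rewrite dotpBl !dotpBr !dotpZl !dotpZr (dotpC v u) -!enorm_sqr => h.
have {}h : 0 <= enorm u ^+ 2 * ((enorm u * enorm v) ^+ 2 - dotp u v ^+ 2).
  by apply: le_trans h _; rewrite le_eqVlt; apply/orP; left; apply/eqP; ring.
rewrite pmulr_rge0 ?exprn_gt0 ?enorm_gt0// subr_ge0 in h.
have := mulr_ge0 (enorm_ge0 u) (enorm_ge0 v).
have [d0|d0 m0] := leP 0 (dotp u v).
  by move=> m0; move: h; rewrite ler_pXn2r ?nnegrE.
by apply: le_trans m0; exact: ltW.
Qed.

Lemma enormD u v : enorm (u + v) <= enorm u + enorm v.
Proof.
rewrite -(@ler_pXn2r _ 2)// ?nnegrE ?addr_ge0 ?enorm_ge0//.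
rewrite enorm_sqr dotpDl !dotpDr (dotpC v u) -!enorm_sqr.
by have := dotp_le u v; lra.
Qed.

Lemma enormB u v w : enorm (u - w) <= enorm (u - v) + enorm (v - w).
Proof. by apply: le_trans (enormD _ _); rewrite addrA subrK. Qed.

Lemma enorm_le_sum u : enorm u <= \sum_i `|u i 0|.
Proof.
have s0 : 0 <= \sum_i `|u i 0| by apply: sumr_ge0.
rewrite -(@ler_pXn2r _ 2)// ?nnegrE ?enorm_ge0// enorm_sqr expr2 mulr_suml.
apply: ler_sum => i _; apply: le_trans (ler_norm _) _; rewrite normrM.
by apply: ler_wpM2l => //; rewrite (bigD1 i)//= lerDl sumr_ge0.
Qed.

Lemma enorm_le_const u a : (forall i, `|u i 0| <= a) -> enorm u <= n%:R * a.
Proof.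
move=> ua; apply: le_trans (enorm_le_sum u) _.
apply: le_trans (ler_sum _ (fun i _ => ua i)) _.
by rewrite sumr_const card_ord mulr_natl.
Qed.

Lemma enorm_mulmx_bound (A : 'M[R]_n) :
  exists2 L : R, 0 <= L & forall u, enorm (A *m u) <= L * enorm u.
Proof.
exists (\sum_i \sum_j `|A i j|) => [|u].
  by apply: sumr_ge0 => i _; exact: sumr_ge0.
apply: le_trans (enorm_le_sum _) _; rewrite mulr_suml.
apply: ler_sum => i _; rewrite mxE; apply: le_trans (ler_norm_sum _ _ _) _.
rewrite mulr_suml; apply: ler_sum => j _; rewrite normrM.
by rewrite ler_wpM2l// enorm_coord.
Qed.

(** Transfers the library topology, given by the sup norm, to Euclidean balls; [enorm_coord] and
    [enorm_le_const] compare the two norms. *)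
Lemma nbhs_enormP x (A : set 'cV[R]_n) :
  nbhs x A <-> exists2 e, 0 < e & forall y, enorm (y - x) < e -> A y.
Proof.
split=> [/nbhs_ballP[e /= e0 xeA]|[e e0 xeA]]; last apply/nbhs_ballP.
  exists e => // y yx; apply: xeA; split=> // i j; rewrite ord1 /ball /=.
  apply: le_lt_trans yx; rewrite distrC.
  by have := enorm_coord (y - x) i; rewrite !mxE.
(* The [+ 1] allows [n = 0] and makes the final inequality strict. *)
have n1 : 0 < n%:R + 1 :> R by rewrite ltr_wpDl.
exists (e / (n%:R + 1)) => /=; first exact: divr_gt0.
move=> y [_ xy]; apply: xeA; apply: (@le_lt_trans _ _ (n%:R * (e / (n%:R + 1)))).
  apply: enorm_le_const => i; rewrite !mxE distrC; apply: ltW.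
  exact: (xy i 0).
by rewrite mulrCA gtr_pMr// ltr_pdivrMr// mul1r ltrDl.
Qed.

Lemma continuous_enormP (f : 'cV[R]_n -> 'cV[R]_n) : continuous f <->
  forall x e, 0 < e -> exists2 d, 0 < d &
    forall y, enorm (y - x) < d -> enorm (f y - f x) < e.
Proof.
split=> fc x.
  move=> e e0; apply/(nbhs_enormP x [set y | enorm (f y - f x) < e]).
  by apply: (fc x [set y | enorm (y - f x) < e]); apply/nbhs_enormP; exists e.
move=> A /nbhs_enormP[e e0 fA]; apply/nbhs_enormP.
by have [d d0 fd] := fc x e e0; exists d => // y /fd /fA.
Qed.

(** A ball is a closed subset of a box, and boxes are compact for row vectors, hence for columns by
    transposition. *)
Lemma compact_cball x r : compact [set y | enorm (y - x) <= r].
Proof.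
pose B := [set v : 'rV[R]_n | forall i, `[x i 0 - r, x i 0 + r]%classic (v ord0 i)].
have cB : compact B.
  by apply: (@rV_compact R n (fun i => `[x i 0 - r, x i 0 + r]%classic)) => i;
    exact: segment_compact.
have cT : continuous (trmx : 'rV[R]_n -> 'cV[R]_n).
  move=> v A /nbhs_ballP[e e0 vA]; apply/nbhs_ballP; exists e => // w [_ vw].
  by apply: vA; split=> // i j; rewrite !mxE; exact: vw.
apply: (@subclosed_compact _ _ (trmx @` B)); last 2 first.
- by apply: continuous_compact cB; exact: continuous_subspaceT.
- move=> y /= yx.
  exists y^T; last by rewrite trmxK.
  move=> i /=; rewrite /= in_itv /= mxE.
  have /= := le_trans (enorm_coord (y - x) i) yx; rewrite !mxE ler_norml.
  by move=> /andP[? ?]; apply/andP; split; lra.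
rewrite -(setCK [set y | _]); apply: open_closedC.
rewrite openE => y /= /negP; rewrite -ltNge => ry; apply/nbhs_enormP.
exists (enorm (y - x) - r) => [|z zy]; first by rewrite subr_gt0.
apply/negP; rewrite -ltNge; have := enormB y z x; rewrite (enormBC y z).
lra.
Qed.

(** Stands in for the extraction of a convergent sequence: the witness sets for [e] generate a
    proper filter, and [x] is one of its cluster points. Applied to the negation of a property, it
    yields uniform constants on compact sets. *)
Lemma compact_near (K : set 'cV[R]_n) (P : R -> 'cV[R]_n -> Prop) : compact K ->
  (forall e e' x, e <= e' -> P e x -> P e' x) ->
  (forall e, 0 < e -> exists2 x, K x & P e x) ->
  exists2 x, K x &
    forall e, 0 < e -> exists2 y, K y & enorm (y - x) < e /\ P e y.
Proof.
move=> cK Pm PK.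
pose F := filter_from [set e : R | 0 < e] (fun e => [set x | K x /\ P e x]).
have FF : ProperFilter F.
  apply: filter_from_proper => [|e /= /PK[x Kx Px]]; last by exists x.
  apply: filter_from_filter; first by exists 1 => /=.
  move=> a b /= a0 b0; exists (Num.min a b) => /=; first by rewrite lt_min a0.
  by move=> x [Kx Px]; split; split=> //; apply: Pm Px; rewrite ge_min lexx ?orbT.
have [|x [Kx cx]] := cK F FF; first by exists 1 => //= x [].
exists x => // e e0.
have [||y [[Ky Py] yx]] := cx [set y | K y /\ P e y] [set y | enorm (y - x) < e].
- by exists e.
- by apply/nbhs_enormP; exists e.
- by exists y.
Qed.

End EuclideanNorm.

(** * Real induction and a Dini mean value inequality *)

Lemma real_induction {R : realType} (P : R -> Prop) :
  P 0 ->
  (forall t, 0 < t <= 1 -> (forall s, 0 <= s < t -> P s) -> P t) ->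
  (forall t, 0 <= t < 1 -> P t ->
    exists2 d, 0 < d & forall s, t < s < t + d -> s <= 1 -> P s) ->
  forall t, 0 <= t <= 1 -> P t.
Proof.
move=> P0 Plim Pstep.
(* Requiring [P] on all of [[0, t]] makes [S] an interval. The limit clause gives [P] at [sup S],
   and the step clause then excludes [sup S < 1]. *)
pose S := [set t : R | 0 <= t <= 1 /\ forall s, 0 <= s <= t -> P s].
have S0 : S 0.
  split=> [|s]; first by rewrite lexx ler01.
  by rewrite -eq_le => /eqP <-.
have supS : has_sup S by split; [exists 0|exists 1 => t [/andP[]]].
have T0 : 0 <= sup S by apply: ub_le_sup S0; case: supS.
have T1 : sup S <= 1 by apply: ge_sup => [|t [/andP[]]//]; exists 0.
have PltT s : 0 <= s < sup S -> P s.
  move=> /andP[s0 sT]; have [|t [_ Pt] st] := @sup_adherent _ _ (sup S - s) _ supS.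
    by rewrite subr_gt0.
  by apply: Pt; rewrite s0 ltW//; lra.
have PT : P (sup S).
  have [T00|T00] := leP (sup S) 0; last by apply: Plim => //; rewrite T00.
  by rewrite (_ : sup S = 0)//; apply/le_anti; rewrite T00.
have PleT s : 0 <= s <= sup S -> P s.
  move=> /andP[s0]; rewrite le_eqVlt => /orP[/eqP->//|sT].
  by apply: PltT; rewrite s0.
have [T_ge1 t /andP[t0 t1]|T_lt1] := leP 1 (sup S).
  by apply: PleT; rewrite t0 (le_trans t1).
have [|d d0 Pd] := Pstep (sup S) _ PT; first by rewrite T0.
suff /(ub_le_sup (proj2 supS)) : S (Num.min 1 (sup S + d / 2)).
  by rewrite ge_min !leNgt T_lt1 /=; lra.
split=> [|s /andP[s0]].
  by rewrite ge_min lexx le_min ler01 /= addr_ge0// divr_ge0// ltW.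
rewrite le_min => /andP[s1 sd]; have [sT|Ts] := leP s (sup S).
  by apply: PleT; rewrite s0.
by apply: Pd => //; rewrite Ts; lra.
Qed.

(** Real induction on [phi t - phi 0 <= (k + e) * t]: continuity passes it to limits from the left,
    and the Dini bound extends it to the right. *)
Lemma dini_mean_value {R : realType} (phi : R -> R) (k : R) :
  (forall t e, 0 < e ->
    exists2 d, 0 < d & forall s, `|s - t| < d -> `|phi s - phi t| < e) ->
  (forall t e, 0 <= t < 1 -> 0 < e -> exists2 d, 0 < d &
    forall s, 0 < s < d -> phi (t + s) - phi t <= (k + e) * s) ->
  phi 1 - phi 0 <= k.
Proof.
move=> phic phid; apply/ler_addgt0Pr => e e0.
suff H t : 0 <= t <= 1 -> phi t - phi 0 <= (k + e) * t.
  by rewrite -[leRHS]mulr1; apply: H; rewrite ler01 lexx.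
move: t; apply: (@real_induction R (fun t => phi t - phi 0 <= (k + e) * t)).
- by rewrite subrr mulr0.
- move=> t /andP[t0 t1] Ps; apply/ler_addgt0Pr => eps eps0.
  have [d d0 phit] := phic t (eps / 2) (divr_gt0 eps0 (ltr0n _ 2)).
  (* A step back from [t]: it stays in [[0, t]], changes [phi] by less than [eps / 2], and changes
     [(k + e) * t] by at most [eps / 2]. *)
  pose h := Num.min (Num.min t (d / 2)) (eps / 2 / (`|k + e| + 1)).
  have ke : 0 < `|k + e| + 1 by rewrite ltr_wpDl.
  have h0 : 0 < h by rewrite !lt_min t0 !divr_gt0.
  have [[ht hd] he] : (h <= t /\ h <= d / 2) /\ h <= eps / 2 / (`|k + e| + 1).
    by rewrite /h !ge_min !lexx ?orbT.
  have := Ps (t - h); rewrite subr_ge0 ht /= ltrBlDr ltrDl h0 => /(_ isT).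
  have /phit : `|t - h - t| < d.
    by rewrite addrAC subrr sub0r normrN gtr0_norm//; lra.
  rewrite ltr_norml => /andP[p1 p2] p3.
  have : (k + e) * (t - h) <= (k + e) * t + eps / 2; last by lra.
  rewrite mulrBr lerD2l lerNl; move: he; rewrite ler_pdivlMr// => he.
  have := ler_norm (- (k + e)); rewrite normrN => nk.
  have := ler_wpM2r (ltW h0) nk; lra.
- move=> t /andP[t0 t1] Pt; have [|d d0 phit] := phid t e _ e0.
    by rewrite t0.
  exists d => // s /andP[ts std] s1; have := phit (s - t).
  by rewrite subr_gt0 ts ltrBlDl std (addrC t) subrK => /(_ isT); lra.
Qed.

(** Convexity with an explicit real parameter, used both for sets of vectors and for sets of
    matrices. *)
Definition segment_closed {R : realType} {V : lmodType R} (W : set V) :=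
  forall x y (s : R), W x -> W y -> 0 <= s <= 1 -> W (x + s *: (y - x)).

(** * Separation of a convex set from a ball *)

Section Separation.
Context {R : realType} {n : nat}.
Implicit Types (u v w x y z : 'cV[R]_n) (W : set 'cV[R]_n) (a e r s : R).

(* [v] is the unit vector of the point of smallest norm in the closure of [W]. *)
Lemma separation_from_ball W r :
  segment_closed W -> 0 < r -> (forall w, W w -> r <= enorm w) ->
  exists2 v, enorm v <= 1 & forall w, W w -> r <= dotp v w.
Proof.
move=> convW r0 rW; have [[w1 Ww1]|W0] := pselect (W !=set0); last first.
  by exists 0 => [|w Ww]; [rewrite enorm0|case: W0; exists w].
pose N := [set enorm w | w in W]; pose d := inf N.
have infN : has_inf N.
  by split; [exists (enorm w1), w1|exists r => _ [w /rW ? <-]].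
have dW w : W w -> d <= enorm w.
  by move=> Ww; apply: ge_inf; [case: infN|exists w].
have rd : r <= d by apply: lb_le_inf => [|_ [w /rW ? <-]//]; case: infN.
(* [w0] is a limit of points of [W] that nearly minimize the norm; it may lie outside [W]. *)
have [||w0 _ w0W] := compact_near _ (fun e w => W w /\ enorm w <= d + e)
    (compact_cball 0 (d + 1)).
- by move=> e e' w ee' [Ww we]; split=> //; lra.
- move=> e e0; have e1 : 0 < Num.min e 1 by rewrite lt_min e0 ltr01.
  have [_ [w Ww <-]] := inf_adherent e1 infN.
  rewrite -/d -ltrBlDl lt_min => /andP[we w_1].
  by exists w; [rewrite /= subr0|split=> //]; lra.
have w0d : enorm w0 <= d.
  apply/ler_addgt0Pr => e e0; have [|w _ [ww0 [_ wd]]] := w0W (e / 2).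
    exact: divr_gt0.
  by have := enormB w0 w 0; rewrite !subr0 (enormBC w0 w); lra.
have dw0 w s : W w -> 0 <= s <= 1 -> d <= enorm (w0 + s *: (w - w0)).
  move=> Ww /andP[s0 s1]; apply/ler_addgt0Pr => e e0.
  have [x _ [xw0 [Wx _]]] := w0W e e0.
  have := dW _ (convW x w s Wx Ww _); rewrite s0 s1 => /(_ isT).
  rewrite (_ : x + _ = (w0 + s *: (w - w0)) + (1 - s) *: (x - w0)); last first.
    by apply/matrixP => i j; rewrite !mxE; ring.
  move=> /le_trans; apply; apply: le_trans (enormD _ _) _; rewrite lerD2l enormZ.
  rewrite ger0_norm ?subr_ge0//; apply: le_trans (ltW xw0).
  by rewrite ler_piMl ?enorm_ge0//; lra.
have d0 : 0 < d by exact: lt_le_trans rd.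
have w0E : enorm w0 = d.
  apply/le_anti; rewrite w0d /=.
  by have := dw0 w1 0 Ww1; rewrite lexx ler01 scale0r addr0 => /(_ isT).
exists (d^-1 *: w0) => [|w Ww].
  by rewrite enormZ w0E ger0_norm ?invr_ge0 ?(ltW d0)// mulVf ?gt_eqF.
apply: le_trans rd _; rewrite dotpZl ler_pdivlMl// -expr2 -{1}w0E enorm_sqr.
(* If [q = <w0, w - w0>] were negative, moving from [w0] towards [w] would give the squared norm
   [d^2 + 2 s q + s^2 m], which is below [d^2] because [s (m + 1) <= - q]. *)
rewrite -subr_ge0 -dotpBr leNgt; apply/negP.
set q := dotp w0 _ => q0; pose m := enorm (w - w0) ^+ 2.
have m0 : 0 <= m by rewrite exprn_ge0 ?enorm_ge0.
pose s := Num.min 1 (- q / (m + 1)).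
have s0 : 0 < s by rewrite lt_min ltr01 divr_gt0 ?oppr_gt0 ?ltr_wpDl.
have [s1 sq] : s <= 1 /\ s <= - q / (m + 1) by rewrite !ge_min !lexx orbT.
have := dw0 w s Ww; rewrite (ltW s0) s1 => /(_ isT).
rewrite -(@ler_pXn2r _ 2)// ?nnegrE ?enorm_ge0 ?(ltW d0)// enorm_sqr.
rewrite dotpDl !dotpDr !dotpZl !dotpZr (dotpC _ w0) -!enorm_sqr w0E -/q -/m.
move: sq; rewrite ler_pdivlMr ?ltr_wpDl// => sq; have := ler_wpM2l (ltW s0) sq.
by have := mulr_gt0 s0 s0; have : s * q < 0; [rewrite pmulr_rlt0|lra].
Qed.

End Separation.

(** * From pseudo-Jacobians to increments *)

Section PseudoJacobianIncrements.
Context {R : realType} {n : nat}.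
Implicit Types (u v w x y z : 'cV[R]_n) (a c e r s : R) (f : 'cV[R]_n -> 'cV[R]_n).
Implicit Types (A B M N : 'M[R]_n) (C : set 'M[R]_n) (D : set 'cV[R]_n).
Implicit Types (Jf : 'cV[R]_n -> set 'M[R]_n).

Definition eball x r : set 'cV[R]_n := [set y | enorm (y - x) < r].

Definition coercive C c :=
  forall A, C A -> forall u, c * enorm u <= enorm (A *m u).

(* [f (z + u) - f z] lies in the closed convex hull of [C *m u], in dual form. *)
Definition increments_in C D f := forall z u v k, D z -> D (z + u) ->
  (forall A, C A -> dotp v (A *m u) <= k) -> dotp v (f (z + u) - f z) <= k.

Lemma eball_segment_closed x r : segment_closed (eball x r).
Proof.
move=> y z s yr zr /andP[s0 s1]; rewrite /eball /=.
rewrite (_ : _ - x = (1 - s) *: (y - x) + s *: (z - x)); last first.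
  by apply/matrixP => i j; rewrite !mxE; ring.
apply: le_lt_trans (enormD _ _) _; rewrite !enormZ !ger0_norm ?subr_ge0//.
have [->|s_lt1] := eqVneq s 1; first by rewrite subrr mul0r add0r mul1r.
have : (1 - s) * enorm (y - x) < (1 - s) * r.
  by rewrite ltr_pM2l// subr_gt0 lt_neqAle s_lt1.
have : s * enorm (z - x) <= s * r by rewrite ler_wpM2l// ltW.
lra.
Qed.

Lemma conormP A a :
  (a%:E <= conorm A)%E <-> forall u, a * enorm u <= enorm (A *m u).
Proof.
split=> [aA u|aA]; last first.
  by apply: le_ereal_inf_tmp => _ [u u1 <-]; rewrite lee_fin -[a]mulr1 -u1.
have [->|u0] := eqVneq u 0; first by rewrite mulmx0 enorm0 mulr0.
have un := enorm_gt0 u u0.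
have : (conorm A <= (enorm (A *m ((enorm u)^-1 *: u)))%:E)%E.
  apply: ereal_inf_lbound; exists ((enorm u)^-1 *: u) => //=.
  by rewrite enormZ gtr0_norm ?invr_gt0// mulVf ?gt_eqF.
move/(le_trans aA); rewrite lee_fin -scalemxAr enormZ gtr0_norm ?invr_gt0//.
by rewrite ler_pdivlMl// mulrC.
Qed.

Lemma opnorm_ge A u : enorm u <= 1 -> enorm (A *m u) <= opnorm A.
Proof.
move=> u1; apply: ub_le_sup; last by exists u.
have [L L0 AL] := enorm_mulmx_bound A; exists L => _ [w /= w1 <-].
by apply: le_trans (AL w) _; rewrite ler_piMr.
Qed.

Lemma op_unit_ball_le A u : op_unit_ball A -> enorm (A *m u) <= enorm u.
Proof.
rewrite /op_unit_ball /= => A1.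
have [->|u0] := eqVneq u 0; first by rewrite mulmx0 enorm0.
have un := enorm_gt0 u u0.
have : enorm (A *m ((enorm u)^-1 *: u)) <= 1.
  apply: le_trans (ltW A1); apply: opnorm_ge.
  by rewrite enormZ gtr0_norm ?invr_gt0// mulVf ?gt_eqF.
by rewrite -scalemxAr enormZ gtr0_norm ?invr_gt0// ler_pdivrMl// mulr1.
Qed.

Lemma convex_set_segment_closed C : convex_set C <-> segment_closed C.
Proof.
split=> [cC A B s CA CB /andP[s0 s1]|sC A B l].
  have := cC B A (Itv01 s0 s1); rewrite !inE => /(_ CB CA).
  congr (C _); rewrite /conv /=; apply/matrixP => i j.
  by rewrite !mxE /unstable.onem; ring.
rewrite !inE => CA CB; have l01 : 0 <= 1 - l%:num <= 1.
  by have : 0 <= l%:num <= 1; [rewrite ge0 le1|lra].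
have := sC A B _ CA CB l01; congr (C _); rewrite /conv /=.
by apply/matrixP => i j; rewrite !mxE /unstable.onem; ring.
Qed.

Lemma convex_hull_segment_closed C : segment_closed (convex_hull C).
Proof.
move=> A B s CA CB s01 D [cD CD].
by apply: (proj1 (convex_set_segment_closed D) cD) => //; [apply: CA|apply: CB].
Qed.

Lemma convex_hull_sub C (E : set 'M[R]_n) :
  segment_closed E -> C `<=` E -> convex_hull C `<=` E.
Proof. by move=> /convex_set_segment_closed cE CE A; apply. Qed.

(** The slack [e] makes the bound on the limsup strict, so it already holds for the supremum over
    some right neighborhood. *)
Lemma upper_dini_le (phi : 'cV[R]_n -> R) x u k e :
  (upper_dini phi x u <= k%:E)%E -> 0 < e -> exists2 d, 0 < d &
    forall s, 0 < s < d -> phi (x + s *: u) - phi x <= (k + e) * s.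
Proof.
move=> phik e0; have : (upper_dini phi x u < (k + e)%:E)%E.
  by apply: le_lt_trans phik _; rewrite lte_fin ltrDl.
rewrite /upper_dini /limf_esup => /ereal_inf_lt[_ [V /= V0 <-]] supV.
case: V0 => d /= d0 dV; exists d => // s /andP[s0 sd].
rewrite -ler_pdivrMr// -lee_fin; apply: le_trans (ltW supV).
apply: ereal_sup_ubound; exists s => //; apply: dV => //=.
by rewrite sub0r normrN gtr0_norm.
Qed.

(** Mean value inequality for [t -> <v, f (z + t u)>]: the segment stays in [D], where the Dini
    derivative is at most the supremum of [<v, M u>] over [M] in [C]. *)
Lemma pseudo_Jacobian_increments f Jf C D : continuous f ->
  pseudo_Jacobian_map f Jf -> segment_closed D ->
  (forall y, D y -> Jf y `<=` C) -> increments_in C D f.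
Proof.
move=> /continuous_enormP fc Jp cD JC z u v k Dz Dzu Ck.
pose phi t := dotp v (f (z + t *: u)).
rewrite dotpBr; have -> : dotp v (f (z + u)) = phi 1 by rewrite /phi scale1r.
have -> : dotp v (f z) = phi 0 by rewrite /phi scale0r addr0.
apply: dini_mean_value => [t e e0|t e /andP[t0 t1] e0].
  have e'0 : 0 < e / (enorm v + 1) by rewrite divr_gt0// ltr_wpDl ?enorm_ge0.
  have [d d0 fd] := fc (z + t *: u) _ e'0.
  exists (d / (enorm u + 1)) => [|s st]; first by rewrite divr_gt0// ltr_wpDl ?enorm_ge0.
  have /fd : enorm (z + s *: u - (z + t *: u)) < d.
    rewrite (_ : _ - _ = (s - t) *: u); last first.
      by apply/matrixP => i j; rewrite !mxE; ring.
    rewrite enormZ; move: st; rewrite ltr_pdivlMr ?ltr_wpDl ?enorm_ge0//.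
    by apply: le_lt_trans; rewrite ler_wpM2l// lerDl.
  rewrite ltr_pdivlMr ?ltr_wpDl ?enorm_ge0// => fe.
  rewrite /phi -dotpBr ltr_norml -ltrN2 opprK -dotpNr; set w := _ - _ in fe *.
  have wv : enorm w * enorm v <= enorm w * (enorm v + 1).
    by rewrite ler_wpM2l ?enorm_ge0// lerDl.
  by have := dotp_le v w; have := dotp_le v (- w); rewrite enormN; lra.
have Dt : D (z + t *: u).
  have := cD z (z + u) t Dz Dzu; rewrite (addrC z u) addrK; apply.
  by rewrite t0 ltW.
have [|d d0 phid] := @upper_dini_le (fun y => dotp v (f y)) (z + t *: u) u k e _ e0.
  have [_ _ Jle] := Jp (z + t *: u); apply: le_trans (Jle u v) _.
  apply: ge_ereal_sup => _ [M JM <-]; rewrite lee_fin.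
  by apply: Ck; exact: JC JM.
by exists d => // s sd; rewrite /phi scalerDl addrA; exact: phid.
Qed.

(** With [b] strictly above [a] and at most the index, [C] is the set of matrices within [b - a] of
    the convex hull of [Jf x]. Upper semicontinuity puts nearby values of [Jf] in [C], and the
    perturbation lowers the coercivity constant from [b] to [a]. *)
Lemma regular_local_hull f Jf x a : continuous f ->
  pseudo_Jacobian_map f Jf -> usc_at Jf x ->
  (a%:E < regularity_index Jf x)%E ->
  exists r C, [/\ 0 < r, segment_closed C, coercive C a,
    forall y, eball x r y -> Jf y `<=` C & increments_in C (eball x r) f].
Proof.
move=> fc Jp Jusc ax.
(* The index can be [+oo], for instance when [n = 0], so a real [b] is picked. *)
have [b ab bx] : exists2 b : R, a < b & (b%:E <= regularity_index Jf x)%E.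
  move: ax; case: (regularity_index Jf x) => [b ab|_|//]; first by exists b.
  by exists (a + 1); [rewrite ltrDl|rewrite leey].
have [d d0 Jd] := Jusc (b - a) (etrans (subr_gt0 _ _) ab).
pose C := [set A | exists2 M, convex_hull (Jf x) M &
  forall u, enorm ((A - M) *m u) <= (b - a) * enorm u].
have JC y : eball x d y -> Jf y `<=` C.
  rewrite /eball /= => yx M JM; have [|A JA [N N1 <-]] := Jd M.
    exists y => //; exists (d^-1 *: (y - x)); last first.
      by rewrite scalerA mulfV ?gt_eqF// scale1r addrC subrK.
    by rewrite /unit_ball /= enormZ gtr0_norm ?invr_gt0// ltr_pdivrMl// mulr1.
  exists A => [|u]; first by move=> E [_]; apply.
  rewrite addrAC subrr add0r -scalemxAl enormZ ger0_norm ?subr_ge0 ?(ltW ab)//.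
  by rewrite ler_wpM2l ?op_unit_ball_le// subr_ge0 ltW.
exists d, C; split=> //.
- move=> A B s [M JM AM] [N JN BN] s01; exists (M + s *: (N - M)) => [|u].
    exact: convex_hull_segment_closed.
  have -> : (A + s *: (B - A) - (M + s *: (N - M))) *m u =
      (1 - s) *: ((A - M) *m u) + s *: ((B - N) *m u).
    rewrite !scalemxAl -mulmxDl; congr (_ *m _).
    by apply/matrixP => i j; rewrite !mxE; ring.
  case/andP: s01 => s0 s1; apply: le_trans (enormD _ _) _.
  rewrite !enormZ !ger0_norm ?subr_ge0//.
  have := ler_wpM2l s0 (BN u); have := ler_wpM2l (etrans (subr_ge0 _ _) s1) (AM u).
  lra.
- move=> A [M JM AM] u.
  have bM : (b%:E <= conorm M)%E.
    by apply: le_trans bx _; apply: ereal_inf_lbound; exists M.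
  have := proj1 (conormP M b) bM u; have := AM u.
  rewrite mulmxBl => AMu bu; have := enormB (M *m u) (A *m u) 0.
  by rewrite !subr0 enormBC; lra.
- by apply: pseudo_Jacobian_increments JC => //; exact: eball_segment_closed.
Qed.

Lemma regularity_index_ge Jf y a C : segment_closed C -> coercive C a ->
  Jf y `<=` C -> (a%:E <= regularity_index Jf y)%E.
Proof.
move=> cC Ca JC; apply: le_ereal_inf_tmp => _ [A JA <-].
by apply/conormP; apply: Ca; exact: convex_hull_sub cC JC A JA.
Qed.

(** Let [v] separate the set of all [A (y - z)] from the ball of radius [c |y - z|]. The constraint
    on increments only gives upper bounds, so it is applied to [- v]; Cauchy-Schwarz concludes. *)
Lemma increments_expanding C D f c : segment_closed C -> coercive C c -> 0 < c ->
  increments_in C D f ->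
  forall y z, D y -> D z -> c * enorm (y - z) <= enorm (f y - f z).
Proof.
move=> cC Cc c0 fC y z Dy Dz.
have [->|yz] := eqVneq y z; first by rewrite !subrr enorm0 mulr0.
have yz0 : 0 < enorm (y - z) by apply: enorm_gt0; rewrite subr_eq0.
have [|||v v1 vC] := @separation_from_ball R n [set A *m (y - z) | A in C]
    (c * enorm (y - z)).
- move=> _ _ s [A CA <-] [B CB <-] s01; exists (A + s *: (B - A)); first exact: cC.
  by rewrite mulmxDl -scalemxAl mulmxBl.
- exact: mulr_gt0.
- by move=> _ [A CA <-]; exact: Cc.
have := fC z (y - z) (- v) (- (c * enorm (y - z))) Dz.
rewrite addrC subrK => /(_ Dy); rewrite dotpNl lerN2 => h.
apply: le_trans (h _) _ => [A CA|]; first by rewrite dotpNl lerN2 vC//; exists A.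
by apply: le_trans (dotp_le _ _) _; rewrite ler_piMl ?enorm_ge0.
Qed.

End PseudoJacobianIncrements.

(** * Primitives of continuous curves *)

Section SegmentPrimitive.
Context {R : realType} {n : nat}.
Implicit Types (u v x : 'cV[R]_n) (a b k s t M : R) (g G : R -> 'cV[R]_n).

Lemma continuous_primitive (phi : R -> R) a b : continuous phi ->
  exists Phi : R -> R, forall t, a <= t <= b -> is_derive t 1 Phi (phi t).
Proof.
move=> phic; pose F (r : R) := (\int[lebesgue_measure]_(t in [set` `[a - 1%R, r]]) (phi t))%R.
exists F => t /andP[at_ tb].
have [|||dF F'] := @continuous_FTC1 R phi (BLeft (a - 1)) t (b + 1) _ _ _ (phic t).
- lra.
- apply: continuous_compact_integrable; first exact: segment_compact.
  exact: continuous_subspaceT.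
- by rewrite /= lte_fin; lra.
by rewrite -F' derive1E; exact: derivableP.
Qed.

Definition primitive_on a b g G := forall t, a <= t <= b ->
  forall i, is_derive t 1 (fun s => G s i 0) (g t i 0).

Lemma primitive_on_exists a b g : (forall i, continuous (fun s => g s i 0)) ->
  exists G, primitive_on a b g G.
Proof.
move=> gc; have [Phi PhiP] := choice (fun i => continuous_primitive _ a b (gc i)).
exists (fun s => \col_i Phi i s) => t tab i.
have := PhiP i t tab; congr (is_derive _ _ _ _).
by apply/funext => s; rewrite mxE.
Qed.

Lemma primitive_on_dotp a b g G v t : primitive_on a b g G -> a <= t <= b ->
  is_derive t 1 (fun s => dotp v (G s)) (dotp v (g t)).
Proof.
move=> gG tab; rewrite /dotp.
have -> : (fun s => \sum_i v i 0 * G s i 0) =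
    \sum_i (fun s => v i 0 * G s i 0) :> (R -> R).
  by apply/funext => s; rewrite fct_sumE.
apply: is_derive_sum => i; have := gG t tab i => dG.
exact: is_deriveZ.
Qed.

Lemma primitive_on_dotp_le a b g G v k : a <= b -> primitive_on a b g G ->
  (forall s, a <= s <= b -> dotp v (g s) <= k) ->
  dotp v (G b - G a) <= k * (b - a).
Proof.
rewrite le_eqVlt => /orP[/eqP->|ab] gG gk; first by rewrite !subrr dotp0r mulr0.
have [||c] := @MVT R (fun s => dotp v (G s)) (fun s => dotp v (g s)) a b ab.
- move=> t; rewrite in_itv /= => /andP[at_ tb].
  by apply: primitive_on_dotp gG _; rewrite !ltW.
- apply: derivable_within_continuous => t; rewrite in_itv /= => tab.
  by have := primitive_on_dotp _ _ _ _ v _ gG tab => -[].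
rewrite in_itv /= => /andP[ac cb]; rewrite dotpBr => ->.
by rewrite ler_wpM2r ?gk ?subr_ge0 ?(ltW ac) ?(ltW cb)// ltW.
Qed.

Lemma primitive_on_norm_le a b g G M : a <= b -> primitive_on a b g G ->
  (forall s, a <= s <= b -> enorm (g s) <= M) ->
  enorm (G b - G a) <= M * (b - a).
Proof.
move=> ab gG gM; have M0 : 0 <= M.
  by apply: le_trans (enorm_ge0 (g a)) (gM a _); rewrite lexx.
set w := G b - G a; have [->|w0] := eqVneq w 0.
  by rewrite enorm0 mulr_ge0 ?subr_ge0.
have := primitive_on_dotp_le a b g G w (enorm w * M) ab gG.
rewrite -/w -enorm_sqr expr2 -mulrA ler_pM2l ?enorm_gt0//; apply=> s sab.
by apply: le_trans (dotp_le _ _) _; rewrite ler_wpM2l ?enorm_ge0 ?gM.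
Qed.

Lemma primitive_onB a b g G g' G' : primitive_on a b g G -> primitive_on a b g' G' ->
  primitive_on a b (fun s => g s - g' s) (fun s => G s - G' s).
Proof.
move=> gG gG' t tab i; have dG := gG t tab i; have dG' := gG' t tab i.
have := is_deriveB dG dG'; congr (is_derive _ _ _ _); last by rewrite !mxE.
by apply/funext => s; rewrite !mxE.
Qed.

Lemma primitive_on_cst a b x : primitive_on a b (fun=> x) (fun s => s *: x).
Proof.
move=> t _ i; have := is_deriveM (is_derive_id t 1) (is_derive_cst (x i 0) t 1).
rewrite /GRing.scale /= mulr0 add0r mulr1; congr (is_derive _ _ _ _).
by apply/funext => s; rewrite mxE.
Qed.

Lemma primitive_on_shift a b g G t : primitive_on (a + t) (b + t) g G ->
  primitive_on a b (fun s => g (s + t)) (fun s => G (s + t)).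
Proof.
move=> gG s sab i; have stab : a + t <= s + t <= b + t by rewrite !lerD2r.
have dG := gG _ stab i.
have ds : is_derive s 1 (fun r => r + t) 1.
  by have := is_deriveD (is_derive_id s 1) (is_derive_cst t s 1); rewrite addr0.
have := @is_derive1_comp R (fun r => G r i 0) (fun r => r + t) s _ _ dG ds.
by rewrite mulr1.
Qed.

End SegmentPrimitive.

Section Averaging.
Context {R : realType} {n : nat}.
Implicit Types (u v x y z : 'cV[R]_n) (a b c e k r s t L M : R).
Implicit Types (f h : 'cV[R]_n -> 'cV[R]_n) (C : set 'M[R]_n).

Lemma continuous_uniform_on h (K : set 'cV[R]_n) e : continuous h -> compact K ->
  0 < e -> exists2 d, 0 < d &
    forall x y, K x -> enorm (y - x) < d -> enorm (h y - h x) < e.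
Proof.
move=> /continuous_enormP hc cK e0; apply: contrapT => nd.
have [||x Kx xP] := compact_near K (fun d x => exists y,
    enorm (y - x) < d /\ e <= enorm (h y - h x)) cK.
- by move=> d d' x dd' [y [yx ?]]; exists y; split=> //; exact: lt_le_trans dd'.
- move=> d d0; apply: contrapT => nx; apply: nd; exists d => // x y Kx yx.
  by rewrite ltNge; apply/negP => ?; apply: nx; exists x => //; exists y.
have e20 : 0 < e / 2 by exact: divr_gt0.
have [d d0 dP] := hc x _ e20; have d20 : 0 < d / 2 by exact: divr_gt0.
have [y _ [yx [z [zy]]]] := xP _ d20; apply/negP; rewrite -ltNge.
have /dP : enorm (y - x) < d by lra.
have /dP : enorm (z - x) < d by have := enormB z y x; lra.
by have := enormB (h z) (h x) (h y); rewrite (enormBC (h x) (h y)); lra.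
Qed.

Lemma continuous_bounded_on h (K : set 'cV[R]_n) : continuous h -> compact K ->
  exists2 M, 0 <= M & forall x, K x -> enorm (h x) <= M.
Proof.
move=> /continuous_enormP hc cK; apply: contrapT => nM.
have [||x Kx xP] := compact_near K (fun d x => 1 < d * enorm (h x)) cK.
- move=> d d' x dd' /lt_le_trans; apply.
  by rewrite ler_wpM2r ?enorm_ge0.
- move=> d d0; apply: contrapT => nx; apply: nM; exists d^-1 => [|x Kx].
    by rewrite invr_ge0 ltW.
  rewrite leNgt; apply/negP => dx; apply: nx; exists x => //.
  by rewrite -ltr_pdivrMl// mulr1.
have [d d0 dP] := hc x 1 ltr01; have hx := enorm_ge0 (h x).
pose e := Num.min d (enorm (h x) + 1)^-1.
have h1 : 0 < enorm (h x) + 1 by rewrite ltr_wpDl.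
have e0 : 0 < e by rewrite lt_min d0 invr_gt0.
have [y _ [yx]] := xP e e0; apply/negP; rewrite -leNgt.
have /dP hyx : enorm (y - x) < d by apply: lt_le_trans yx _; rewrite ge_min lexx.
have hy : enorm (h y) <= enorm (h x) + 1.
  by have := enormB (h y) (h x) 0; rewrite !subr0; lra.
apply: (@le_trans _ _ ((enorm (h x) + 1)^-1 * (enorm (h x) + 1))).
  by apply: ler_pM; rewrite ?enorm_ge0 ?(ltW e0)// ge_min lexx orbT.
by rewrite mulVf// gt_eqF.
Qed.

Lemma enorm_delta (i : 'I_n) t : enorm (t *: delta_mx i 0 : 'cV[R]_n) = `|t|.
Proof.
rewrite enormZ [X in _ * X](_ : _ = 1) ?mulr1// /enorm (bigD1 i)//= big1.
  by rewrite mxE !eqxx expr1n addr0 sqrtr1.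
by move=> j ji; rewrite mxE (negbTE ji) expr0n.
Qed.

(* The average of [h] over the segments [x, x + w *: e_i]. *)
Lemma steklov_average h (i : 'I_n) w : continuous h -> 0 < w <= 1 ->
  let e_i := delta_mx i 0 : 'cV[R]_n in
  exists h' : 'cV[R]_n -> 'cV[R]_n,
  [/\ forall x z v k, (forall s, 0 <= s <= w ->
          dotp v (h (x + s *: e_i) - h (z + s *: e_i)) <= k) ->
        dotp v (h' x - h' z) <= k,
      forall x z M, (forall s, 0 <= s <= w ->
          enorm (h (x + s *: e_i) - h (z + s *: e_i)) <= M) ->
        enorm (h' x - h' z) <= M,
      forall x M, (forall s, 0 <= s <= w -> enorm (h (x + s *: e_i) - h x) <= M) ->
        enorm (h' x - h x) <= M &
      forall x M t, (forall s, -2 <= s <= 2 -> enorm (h (x + s *: e_i)) <= M) ->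
        `|t| <= 1 -> enorm (h' (x + t *: e_i) - h' x) <= 2 * M / w * `|t|].
Proof.
move=> /[dup] hc /continuous_enormP hc' /andP[w0 w1] e_i.
pose g x s := h (x + s *: e_i).
have gc x j : continuous (fun s => g x s j 0).
  move=> s; apply/cvgrPdist_lt => /= e e0.
  have [d d0 dP] := hc' (x + s *: e_i) e e0; near=> t.
  have /dP : enorm (x + t *: e_i - (x + s *: e_i)) < d.
    rewrite opprD addrACA subrr add0r -scalerBl enorm_delta distrC.
    by near: t; apply/nbhs_ballP; exists d.
  apply: le_lt_trans; rewrite distrC.
  by have := enorm_coord (g x t - g x s) j; rewrite !mxE.
have [G GP] := choice (fun x => primitive_on_exists (-2) 2 (g x) (gc x)).
have Gsub x a b : -2 <= a -> b <= 2 -> primitive_on a b (g x) (G x).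
  by move=> a2 b2 t /andP[ta tb]; apply: GP; lra.
have Gw x : primitive_on 0 w (g x) (G x) by apply: Gsub; lra.
have wV : 0 <= w^-1 by rewrite invr_ge0 ltW.
have G0w x : w^-1 *: (G x w - G x 0) - h x = w^-1 *: (G x w - w *: h x - (G x 0 - 0 *: h x)).
  rewrite !scalerBr scalerA mulVf ?gt_eqF// scale1r scale0r scaler0 subr0.
  by rewrite addrAC.
have Gdiff x z : w^-1 *: (G x w - G x 0) - w^-1 *: (G z w - G z 0) =
    w^-1 *: (G x w - G z w - (G x 0 - G z 0)).
  by apply/matrixP => a b; rewrite !mxE; ring.
exists (fun x => w^-1 *: (G x w - G x 0)); split.
- move=> x z v k xzk; rewrite Gdiff dotpZr ler_pdivrMl// mulrC -[in leRHS](subr0 w).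
  exact: primitive_on_dotp_le (ltW w0) (primitive_onB _ _ _ _ _ _ (Gw x) (Gw z)) xzk.
- move=> x z M xzM; rewrite Gdiff enormZ ger0_norm// ler_pdivrMl// mulrC -[in leRHS](subr0 w).
  exact: primitive_on_norm_le (ltW w0) (primitive_onB _ _ _ _ _ _ (Gw x) (Gw z)) xzM.
- move=> x M xM; rewrite G0w enormZ ger0_norm// ler_pdivrMl// mulrC -[in leRHS](subr0 w).
  exact: primitive_on_norm_le (ltW w0)
    (primitive_onB _ _ _ _ _ _ (Gw x) (primitive_on_cst _ _ _)) xM.
- move=> x M t xM; rewrite ler_norml => /andP[t1 t2].
  have Gt : primitive_on 0 w (g (x + t *: e_i)) (fun s => G x (s + t)).
    have := primitive_on_shift 0 w (g x) (G x) t (Gsub x _ _ _ _).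
    have -> : (fun s => g x (s + t)) = g (x + t *: e_i).
      by apply/funext => s; rewrite /g scalerDl addrCA addrC.
    by apply; lra.
  have /eqP : enorm (G (x + t *: e_i) w - G x (w + t) -
      (G (x + t *: e_i) 0 - G x (0 + t))) = 0.
    apply/le_anti; rewrite enorm_ge0 andbT -[leRHS](mul0r (w - 0)).
    apply: (primitive_on_norm_le _ _ _ _ _ (ltW w0) (primitive_onB _ _ _ _ _ _ (Gw _) Gt)).
    by move=> s _; rewrite subrr enorm0.
  move=> /eqP /enorm_eq0; rewrite add0r => G0.
  have -> : w^-1 *: (G (x + t *: e_i) w - G (x + t *: e_i) 0) -
      w^-1 *: (G x w - G x 0) =
      w^-1 *: (G x (w + t) - G x w - (G x t - G x 0)).
    rewrite -scalerBr; congr (_ *: _); apply/eqP; rewrite -subr_eq0 -G0; apply/eqP.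
    by apply/matrixP => p q; rewrite !mxE; ring.
  have lip a b : -2 <= a -> a <= b -> b <= 2 -> enorm (G x b - G x a) <= M * (b - a).
    move=> a2 ab b2; apply: primitive_on_norm_le ab (Gsub x a b a2 b2) _ => s sab.
    by apply: xM; lra.
  have lipt a : 0 <= a <= 1 -> enorm (G x (a + t) - G x a) <= M * `|t|.
    move=> /andP[a0 a1]; have [t0|t0] := leP 0 t.
      by apply: le_trans (lip _ _ _ _ _) _; [lra..|rewrite (addrC a) addrK ger0_norm].
    rewrite enormBC; apply: le_trans (lip _ _ _ _ _) _; [lra..|].
    by rewrite opprD addrA subrr sub0r ltr0_norm.
  rewrite enormZ ger0_norm// ler_pdivrMl//.
  have -> : w * (2 * M / w * `|t|) = M * `|t| + M * `|t|.
    by field; rewrite gt_eqF.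
  have := lipt w; rewrite (ltW w0) w1 => /(_ isT) lw.
  have := lipt 0; rewrite lexx ler01 add0r => /(_ isT) l0.
  by have := enormD (G x (w + t) - G x w) (- (G x t - G x 0)); rewrite enormN; lra.
Unshelve. all: by end_near. Qed.

Lemma enorm_le_coord u v : (forall i, `|u i 0| <= `|v i 0|) -> enorm u <= enorm v.
Proof.
move=> uv; apply: ler_wsqrtr; apply: ler_sum => i _.
by rewrite -[leLHS]real_normK ?num_real// -[leRHS]real_normK ?num_real// lerXn2r ?nnegrE.
Qed.

(* [y] is reached from [z] by changing one coordinate at a time. *)
Lemma coordinate_lipschitz h x r L : 0 <= L ->
  (forall (i : 'I_n) z t, enorm (z - x) <= r + 1 -> `|t| <= 1 ->
    enorm (h (z + t *: delta_mx i 0) - h z) <= L * `|t|) ->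
  forall y z, enorm (z - x) <= r -> enorm (y - z) <= 1 ->
    enorm (h y - h z) <= n%:R * L * enorm (y - z).
Proof.
move=> L0 hL y z zx yz.
pose p (m : nat) : 'cV[R]_n := \col_(j < n) (if (j < m)%N then y j 0 else z j 0).
have pz m : enorm (p m - z) <= enorm (y - z).
  by apply: enorm_le_coord => i; rewrite !mxE; case: ifP; rewrite ?subrr ?normr0.
have -> : y = p n by apply/matrixP => i j; rewrite mxE ltn_ord ord1.
suff H (m : nat) : (m <= n)%N -> enorm (h (p m) - h z) <= m%:R * L * enorm (p n - z).
  exact: H.
have -> : p n = y by apply/matrixP => i j; rewrite mxE ltn_ord ord1.
elim: m => [_|m IH mn].
  have -> : p 0 = z by apply/matrixP => i j; rewrite mxE ltn0 ord1.
  by rewrite subrr enorm0 !mul0r.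
pose i := Ordinal mn; pose t := y i 0 - z i 0.
have pS : p m.+1 = p m + t *: delta_mx i 0.
  apply/matrixP => j l; rewrite !mxE ord1 ltnS leq_eqVlt andbT.
  have [->|ji] := eqVneq j i; first by rewrite eqxx ltnn /= mulr1 addrC subrK.
  rewrite mulr0 addr0; case: eqP => // jk; case/eqP: ji; exact: val_inj.
have ty : `|t| <= enorm (y - z).
  by have := enorm_coord (y - z) i; rewrite !mxE.
have pkx : enorm (p m - x) <= r + 1.
  by have := enormB (p m) z x; have := pz m; lra.
have := hL i (p m) t pkx (le_trans ty yz); rewrite -pS => hpS.
have := enormB (h (p m.+1)) (h (p m)) (h z); have := IH (ltnW mn).
have := ler_wpM2l L0 ty; rewrite -natr1; lra.
Qed.

Lemma smoothing f C x r : continuous f -> increments_in C (eball x r) f ->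
  forall r' e, r' < r -> 0 < e -> exists h,
  [/\ continuous h, forall y, eball x r' y -> enorm (h y - f y) <= e,
      increments_in C (eball x r') h &
      forall b, exists2 L, 0 <= L & forall y z, enorm (z - x) <= b ->
        enorm (y - z) <= 1 -> enorm (h y - h z) <= L * enorm (y - z)].
Proof.
move=> fc fC.
pose lip m h := forall b, exists2 L, 0 <= L & forall (i : 'I_n) z t, (i < m)%N ->
  enorm (z - x) <= b -> `|t| <= 1 ->
  enorm (h (z + t *: delta_mx i 0) - h z) <= L * `|t|.
suff H (m : nat) : (m <= n)%N -> forall r' e, r' < r -> 0 < e -> exists h,
    [/\ continuous h, forall y, eball x r' y -> enorm (h y - f y) <= e,
      increments_in C (eball x r') h & lip m h].
  move=> r' e r'r e0; have [h [hc hf hC hlip]] := H n (leqnn n) r' e r'r e0.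
  exists h; split=> // b; have [L L0 hL] := hlip (b + 1).
  exists (n%:R * L) => [|y z zx yz]; first by rewrite mulr_ge0.
  by apply: (coordinate_lipschitz h x b) yz => // i w t; apply: hL.
elim: m => [_|m IH mn] r' e r'r e0.
  exists f; split=> //.
  - by move=> y _; rewrite subrr enorm0 ltW.
  - by move=> z u v a zr zur; apply: fC; exact: lt_trans r'r.
  - by move=> b; exists 0.
have [r2 e20] : (r' + r) / 2 < r /\ 0 < e / 2 by split; [lra|exact: divr_gt0].
have [h [hc hf hC hlip]] := IH (ltnW mn) _ _ r2 e20.
have [d d0 hd] := continuous_uniform_on h _ _ hc (compact_cball x r) e20.
pose w := Num.min 1 (Num.min (d / 2) ((r - r') / 2)).
have w0 : 0 < w by rewrite !lt_min ltr01 !divr_gt0// subr_gt0.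
have [w1 [wd wr]] : w <= 1 /\ (w <= d / 2 /\ w <= (r - r') / 2).
  by rewrite !ge_min !lexx !orbT.
have w01 : 0 < w <= 1 by rewrite w0.
have [h' [h'dot h'norm h'h h'lip]] := steklov_average h (Ordinal mn) w hc w01.
set e_k : 'cV[R]_n := delta_mx (Ordinal mn) 0 in h'dot h'norm h'h h'lip *.
have shift y s a : `|s| <= a -> enorm (y + s *: e_k - x) <= enorm (y - x) + a.
  move=> sa; rewrite addrAC; apply: le_trans (enormD _ _) _.
  by rewrite lerD2l enorm_delta.
have ws s : 0 <= s <= w -> `|s| <= w by move=> /andP[? ?]; rewrite ger0_norm.
exists h'; split.
- apply/continuous_enormP => y a a0; have a20 : 0 < a / 2 by exact: divr_gt0.
  have [q q0 hq] := continuous_uniform_on h _ _ hc (compact_cball y 1) a20.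
  exists q => // z zy; apply: (@le_lt_trans _ _ (a / 2)); last lra.
  apply: h'norm => s sw; apply/ltW/hq.
    by rewrite /= addrAC subrr add0r enorm_delta (le_trans (ws s sw)).
  by rewrite opprD addrACA subrr addr0.
- rewrite /eball /= => y yr; have hfy : enorm (h y - f y) <= e / 2.
    by apply: hf; rewrite /eball /=; lra.
  have := enormB (h' y) (h y) (f y); suff : enorm (h' y - h y) <= e / 2 by lra.
  apply: h'h => s sw; apply/ltW/hd => /=; first by lra.
  by rewrite addrAC subrr add0r enorm_delta; have := ws s sw; lra.
- move=> z u v a; rewrite /eball /= => zr zur Ca; apply: h'dot => s sw.
  rewrite addrAC; apply: hC => //.
    by rewrite /eball /=; have := shift z s w (ws s sw); lra.
  by rewrite /eball /= (addrAC z); have := shift (z + u) s w (ws s sw); lra.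
- move=> b; have [L L0 hL] := hlip (b + 1).
  have [M M0 hM] := continuous_bounded_on h _ hc (compact_cball x (b + 2)).
  have Mw : 0 <= 2 * M / w by rewrite divr_ge0 ?mulr_ge0// ltW.
  exists (L + 2 * M / w) => [|i z t ik zb t1]; first exact: addr_ge0.
  have t0 := normr_ge0 t.
  have := ik; rewrite ltnS leq_eqVlt => /orP[/eqP ik'|ik'].
    have -> : i = Ordinal mn by exact: val_inj.
    apply: (@le_trans _ _ (2 * M / w * `|t|)); last by rewrite ler_wpM2r// lerDr.
    apply: h'lip t1 => s s2; apply: hM => /=.
    have : `|s| <= 2 by rewrite ler_norml.
    by move=> /(shift z s 2); lra.
  apply: (@le_trans _ _ (L * `|t|)); last by rewrite ler_wpM2r// lerDl.
  apply: h'norm => s sw; rewrite addrAC; apply: hL => //.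
  by have := shift z s w (ws s sw); lra.
Qed.

End Averaging.

Section Covering.
Context {R : realType} {n : nat}.
Implicit Types (u v x y z : 'cV[R]_n) (a b c e r s t L M : R).
Implicit Types (f h : 'cV[R]_n -> 'cV[R]_n) (A : 'M[R]_n) (C : set 'M[R]_n).

Lemma coercive_trmx A c : 0 < c -> (forall u, c * enorm u <= enorm (A *m u)) ->
  forall u, c * enorm u <= enorm (A^T *m u).
Proof.
move=> c0 cA u.
have uA : A \in unitmx.
  rewrite -unitmx_tr -row_free_unit; apply: inj_row_free => v vA.
  have Av : A *m v^T = 0 by rewrite -[A]trmxK -trmx_mul vA trmx0.
  have := cA v^T; rewrite Av enorm0 pmulr_rle0// => v0.
  by rewrite -[v]trmxK (enorm_eq0 v^T) ?trmx0//; apply/le_anti; rewrite v0 enorm_ge0.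
have := dotp_mulmx A u (invmx A *m u); rewrite mulmxA mulmxV// mul1mx -enorm_sqr => uu.
have := dotp_le (A^T *m u) (invmx A *m u); rewrite -uu.
have := cA (invmx A *m u); rewrite mulmxA mulmxV// mul1mx => iu.
have [->|u0] := eqVneq u 0; first by rewrite enorm0 mulr0 enorm_ge0.
move/(ler_wpM2l (ltW c0)); rewrite expr2 mulrCA [leRHS]mulrCA => cu.
have {}cu := le_trans cu (ler_wpM2l (enorm_ge0 (A^T *m u)) iu).
by move: cu; rewrite mulrC ler_pM2r// enorm_gt0.
Qed.

(* A minimizer of the distance to the target has a descent direction, unless it
   is a solution. Local Lipschitz continuity makes the quadratic error of the
   squared distance negligible; it does not hold for [f] itself. *)
Lemma lipschitz_covering h C x r r' c : 0 < r < r' -> 0 < c -> segment_closed C ->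
  coercive C c -> increments_in C (eball x r') h ->
  (forall b, exists2 L, 0 <= L & forall y z, enorm (z - x) <= b ->
        enorm (y - z) <= 1 -> enorm (h y - h z) <= L * enorm (y - z)) ->
  forall y, enorm (y - h x) < c * r / 2 ->
  exists2 z, enorm (z - x) <= r & h z = y.
Proof.
move=> /andP[r0 rr'] c0 cC Cc hC hlip y yx.
have [L L0 hL] := hlip r.
pose N := [set enorm (h z - y) | z in [set z | enorm (z - x) <= r]].
have infN : has_inf N.
  split; first by exists (enorm (h x - y)), x => //=; rewrite subrr enorm0 ltW.
  by exists 0 => _ [z _ <-]; exact: enorm_ge0.
pose m := inf N.
have mN z : enorm (z - x) <= r -> m <= enorm (h z - y).
  by move=> zr; apply: ge_inf; [case: infN|exists z].
have [||z /= zr zP] := compact_near _ (fun e z => enorm (h z - y) <= m + e)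
    (compact_cball x r).
- by move=> e e' z ee' /le_trans; apply; rewrite lerD2l.
- move=> e e0; have [_ [z zr <-]] := inf_adherent e0 infN.
  by exists z => //; exact: ltW.
have hzm : enorm (h z - y) <= m.
  apply/ler_addgt0Pr => e e0; pose d := Num.min 1 (e / (L + 1)).
  have L1 : 0 < L + 1 by rewrite ltr_wpDl.
  have d0 : 0 < d by rewrite lt_min ltr01 divr_gt0.
  have [d1 de] : d <= 1 /\ d <= e / (L + 1) by rewrite !ge_min !lexx orbT.
  have [w wr [wz wm]] := zP d d0.
  have := hL w z zr (le_trans (ltW wz) d1).
  have := ler_wpM2l L0 (ltW wz); move: de; rewrite ler_pdivlMr//.
  have := enormB (h z) (h w) y; rewrite (enormBC (h z) (h w)); lra.
have zr' : enorm (z - x) < r.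
  have := increments_expanding C _ h c cC Cc c0 hC z x.
  rewrite /eball /= subrr enorm0 => /(_ (le_lt_trans zr rr') (lt_trans r0 rr')) zx.
  have := mN x; rewrite subrr enorm0 => /(_ (ltW r0)) mx.
  rewrite -(ltr_pM2l c0); have := enormB (h z) y (h x).
  rewrite (enormBC (h x)) in mx; lra.
exists z => //; apply/eqP; rewrite -subr_eq0; apply/negPn/negP => w0.
set w := h z - y in w0 hzm; have nw := enorm_gt0 w w0.
have cw : 0 < c * enorm w by exact: mulr_gt0.
have [|||v v1 vC] := @separation_from_ball R n [set A^T *m w | A in C] (c * enorm w).
- move=> _ _ s [A CA <-] [B CB <-] s01; exists (A + s *: (B - A)); first exact: cC.
  have -> : (A + s *: (B - A))^T = A^T + s *: (B^T - A^T).
    by apply/matrixP => i j; rewrite !mxE.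
  by rewrite mulmxDl -scalemxAl mulmxBl.
- exact: cw.
- by move=> _ [A CA <-]; apply: coercive_trmx => //; exact: Cc.
pose t := Num.min 1 (Num.min (r - enorm (z - x)) (c * enorm w / (L ^+ 2 + 1))).
have L21 : 0 < L ^+ 2 + 1 by rewrite ltr_wpDl ?sqr_ge0.
have t0 : 0 < t by rewrite !lt_min ltr01 subr_gt0 zr' divr_gt0.
have [t1 [tr tc]] : t <= 1 /\ (t <= r - enorm (z - x) /\ t <= c * enorm w / (L ^+ 2 + 1)).
  by rewrite !ge_min !lexx !orbT.
have tv : enorm (- t *: v) <= t.
  by rewrite enormZ normrN gtr0_norm// ler_piMr// ltW.
have ztr : enorm (z + - t *: v - x) <= r.
  by rewrite addrAC; apply: le_trans (enormD _ _) _; lra.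
have := hC z (- t *: v) w (- t * (c * enorm w)) (le_lt_trans zr rr') (le_lt_trans ztr rr').
set dh := h _ - _ => hd.
have {}hd : dotp w dh <= - t * (c * enorm w).
  apply: hd => A CA; rewrite -scalemxAr dotpZr !mulNr lerN2 ler_pM2l//.
  by rewrite dotp_mulmx dotpC; apply: vC; exists A.
have dhL : enorm dh <= L * t.
  have := hL (z + - t *: v) z zr; rewrite (addrC z) addrK => /(_ (le_trans tv t1)).
  by rewrite addrC; move/le_trans; apply; rewrite ler_wpM2l.
have := le_trans hzm (mN _ ztr).
have -> : h (z + - t *: v) - y = w + dh.
  by rewrite /w /dh [RHS]addrC addrA subrK.
clearbody dh w.
rewrite -(@ler_pXn2r _ 2)// ?nnegrE ?enorm_ge0// !enorm_sqr dotpDl !dotpDr (dotpC dh w).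
rewrite -(enorm_sqr dh).
have : enorm dh ^+ 2 <= (L * t) ^+ 2.
  by rewrite ler_pXn2r ?nnegrE ?enorm_ge0// mulr_ge0// ltW.
move: tc; rewrite ler_pdivlMr// => tc; have := ler_wpM2l (ltW t0) tc.
have := mulr_gt0 t0 cw; have := mulr_gt0 t0 t0.
rewrite exprMn; lra.
Qed.

Lemma increments_covering f C x r r' c : 0 < r < r' -> 0 < c -> segment_closed C ->
  coercive C c -> continuous f -> increments_in C (eball x r') f ->
  forall y, enorm (y - f x) < c * r / 2 ->
  exists2 z, enorm (z - x) <= r & f z = y.
Proof.
move=> /andP[r0 rr'] c0 cC Cc fc fC y yx.
have [||z /= zr zP] := compact_near _ (fun e z => enorm (f z - y) <= e)
    (compact_cball x r).
- by move=> e e' z ee' /le_trans; apply.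
- move=> e e0; pose d := Num.min e ((c * r / 2 - enorm (y - f x)) / 2).
  have d0 : 0 < d by rewrite lt_min e0 divr_gt0// subr_gt0.
  have [de dc] : d <= e /\ d <= (c * r / 2 - enorm (y - f x)) / 2.
    by rewrite !ge_min !lexx orbT.
  have rm : (r + r') / 2 < r' by lra.
  have [h [_ hf hC hlip]] := smoothing f C x r' fc fC _ d rm d0.
  have rr : 0 < r < (r + r') / 2 by lra.
  have [|z zr hz] := lipschitz_covering h C x r _ c rr c0 cC Cc hC hlip y.
    have := hf x; rewrite /eball /= subrr enorm0 => /(_ _) hfx.
    have := enormB y (f x) (h x); rewrite (enormBC (f x)).
    have : enorm (h x - f x) <= d by apply: hfx; lra.
    lra.
  exists z => //; rewrite enormBC -hz.
  by apply: le_trans de; apply: hf; rewrite /eball /=; lra.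
exists z => //; apply/eqP; rewrite -subr_eq0; apply/eqP/enorm_eq0/le_anti.
rewrite enorm_ge0 andbT; apply/ler_addgt0Pr => e e0; rewrite add0r.
have e20 : 0 < e / 2 by exact: divr_gt0.
have [d d0 fd] := proj1 (continuous_enormP f) fc z _ e20.
have m0 : 0 < Num.min d (e / 2) by rewrite lt_min d0.
have [w _ []] := zP _ m0; rewrite lt_min le_min => /andP[/fd wz _] /andP[_ wy].
have := enormB (f z) (f w) y; rewrite (enormBC (f z) (f w)); lra.
Qed.

End Covering.

Section PathLifting.
Context {R : realType} {n : nat}.
Implicit Types (u v w x y z : 'cV[R]_n) (a b c d e r s t L : R).
Implicit Types (f g : 'cV[R]_n -> 'cV[R]_n) (p q : R -> 'cV[R]_n).

Definition expanding_at f c x r := forall y z, eball x r y -> eball x r z ->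
  c * enorm (y - z) <= enorm (f y - f z).

Definition locally_open f := forall x r, 0 < r -> exists2 d, 0 < d &
  forall y, enorm (y - f x) < d -> exists2 z, eball x r z & f z = y.

Lemma eball_center x r : 0 < r -> eball x r x.
Proof. by rewrite /eball /= subrr enorm0. Qed.

Lemma expanding_at_inj f c x r y z : 0 < c -> expanding_at f c x r ->
  eball x r y -> eball x r z -> f y = f z -> y = z.
Proof.
move=> c0 fx xy xz fyz; have := fx y z xy xz.
rewrite fyz subrr enorm0 pmulr_rle0// => yz.
by apply/eqP; rewrite -subr_eq0; apply/eqP/enorm_eq0/le_anti; rewrite yz enorm_ge0.
Qed.

Lemma expanding_uniform f (K : set 'cV[R]_n) : compact K ->
  (forall x, exists c r, [/\ 0 < c, 0 < r & expanding_at f c x r]) ->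
  exists2 c, 0 < c & forall x, K x -> expanding_at f c x c.
Proof.
move=> cK floc; apply: contrapT => nc.
have [||x Kx xP] := compact_near K (fun e x => ~ expanding_at f e x e) cK.
- move=> e e' x ee' + fe'; apply=> y z /lt_le_trans xy /lt_le_trans xz.
  apply: le_trans (fe' y z (xy _ ee') (xz _ ee')).
  by rewrite ler_wpM2r ?enorm_ge0.
- move=> e e0; apply: contrapT => ne; apply: nc; exists e => // x Kx.
  by apply: contrapT => ?; apply: ne; exists x.
have [c [r [c0 r0 fc]]] := floc x.
have m0 : 0 < Num.min c (r / 2) by rewrite lt_min c0 divr_gt0.
have [mc mr] : Num.min c (r / 2) <= c /\ Num.min c (r / 2) <= r / 2.
  by rewrite !ge_min !lexx orbT.
have [y _ [yx]] := xP _ m0; apply; move: (Num.min c (r / 2)) => m in m0 mc mr yx *.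
have yr z : eball y m z -> eball x r z.
  by rewrite /eball /= => zy; have := enormB z y x; lra.
move=> z w /yr zx /yr wx; apply: le_trans (fc z w zx wx).
by rewrite ler_wpM2r ?enorm_ge0.
Qed.

Definition lifts f x v L t p := [/\ p 0 = x,
  forall s, 0 <= s <= t -> f (p s) = f x + s *: v &
  forall s s', 0 <= s -> s <= s' -> s' <= t -> enorm (p s' - p s) <= L * (s' - s)].

Lemma lifts_compare f x v v' L L' t p q c : 0 <= L -> 0 <= L' -> 0 <= t <= 1 ->
  0 < c -> lifts f x v L t p -> lifts f x v' L' t q ->
  (forall s, 0 <= s <= t -> expanding_at f c (p s) c) ->
  enorm (v - v') < c * c ->
  forall s, 0 <= s <= t -> enorm (p s - q s) <= enorm (v - v') / c.
Proof.
move=> L0 L'0 /andP[t0 t1] c0 [p0 fp pL] [q0 fq qL] fc vv' s /andP[s0 st].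
have LL : 0 < L + L' + 1 by rewrite ltr_wpDl ?addr_ge0.
have near s1 s2 : 0 <= s1 -> s1 <= s2 -> s2 <= t ->
    `|enorm (p s2 - q s2) - enorm (p s1 - q s1)| <= (L + L' + 1) * (s2 - s1).
  move=> s10 s12 s2t; have := pL _ _ s10 s12 s2t; have := qL _ _ s10 s12 s2t.
  have := enormB (p s2) (p s1) (q s2); have := enormB (p s1) (q s1) (q s2).
  have := enormB (p s1) (p s2) (q s1); have := enormB (p s2) (q s2) (q s1).
  rewrite (enormBC (p s1) (p s2)) (enormBC (q s1) (q s2)) ler_norml; lra.
suff : s <= t -> enorm (p s - q s) <= enorm (v - v') / c by apply.
have : 0 <= s <= 1 by rewrite s0 (le_trans st).
move: s {s0 st}.
apply: (@real_induction R (fun s => s <= t -> enorm (p s - q s) <= enorm (v - v') / c)).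
- by move=> _; rewrite p0 q0 subrr enorm0 divr_ge0 ?enorm_ge0// ltW.
- move=> s /andP[s0 s1] Ps st; apply/ler_addgt0Pr => e e0.
  pose h := Num.min s (e / (L + L' + 1)).
  have h0 : 0 < h by rewrite lt_min s0 divr_gt0.
  have [hs he] : h <= s /\ h <= e / (L + L' + 1) by rewrite !ge_min !lexx orbT.
  move: he; rewrite ler_pdivlMr// => he.
  have := Ps (s - h); rewrite subr_ge0 hs ltrBlDr ltrDl h0 => /(_ isT).
  have sh : s - h <= s by lra.
  move=> /(_ (le_trans sh st)).
  have := near (s - h) s; rewrite subr_ge0 => /(_ hs sh st).
  rewrite opprB addrCA subrr addr0 ler_norml => /andP[_]; lra.
- move=> s /andP[s0 s1] Ps; have [st|ts] := leP s t; last first.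
    exists 1 => // s' /andP[ss' _] _ s't.
    by have := lt_trans ts ss'; rewrite ltNge s't.
  have {}Ps : enorm (p s - q s) < c.
    by apply: le_lt_trans (Ps st) _; rewrite ltr_pdivrMr.
  exists ((c - enorm (p s - q s)) / (L + L' + 1)).
    by rewrite divr_gt0// subr_gt0.
  move=> s' /andP[ss']; rewrite -ltrBlDl ltr_pdivlMr// => s'c s'1 s't.
  have := near s s' s0 (ltW ss') s't; rewrite ler_norml => /andP[_ nss'].
  have s'0 : 0 <= s' by apply: le_trans s0 (ltW ss').
  have s'i : 0 <= s' <= t by rewrite s'0.
  have := fc s' s'i (p s') (q s') (eball_center _ _ c0).
  rewrite /eball /= (enormBC (q s')) fp// fq// opprD addrACA subrr add0r -scalerBr.
  rewrite enormZ ger0_norm// => h; rewrite ler_pdivlMr// mulrC.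
  apply: le_trans (h _) _; first by lra.
  by rewrite ler_piMl ?enorm_ge0.
Qed.

Lemma lifts_unique f x v L t p q : 0 <= L -> 0 <= t <= 1 ->
  (forall y, exists c r, [/\ 0 < c, 0 < r & expanding_at f c y r]) ->
  lifts f x v L t p -> lifts f x v L t q -> forall s, 0 <= s <= t -> p s = q s.
Proof.
move=> L0 t01 floc pl ql s st; case/andP: (t01) => t0 t1.
have [c c0 fc] := expanding_uniform f _ (compact_cball x L) floc.
have := lifts_compare f x v v L L t p q c L0 L0 t01 c0 pl ql _ _ s st.
rewrite subrr enorm0 mul0r => h.
apply/eqP; rewrite -subr_eq0; apply/eqP/enorm_eq0/le_anti.
rewrite enorm_ge0 andbT; apply: h; last exact: mulr_gt0.
move=> s1 /andP[s10 s1t]; apply: fc => /=; case: pl => p0 _ pL.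
rewrite -{1}p0; apply: le_trans (pL 0 s1 _ s10 s1t) _ => //.
by rewrite subr0 ler_piMr// (le_trans s1t).
Qed.

Lemma lifts_exist f x v a : continuous f -> locally_open f -> 0 < a ->
  (forall y, exists c r, [/\ 0 < c, 0 < r & expanding_at f c y r]) ->
  (forall y, enorm (f y - f x) <= enorm v ->
    exists2 r, 0 < r & expanding_at f a y r) ->
  exists p, lifts f x v (enorm v / a) 1 p.
Proof.
move=> fc fo a0 floc fa; set L := enorm v / a.
have L0 : 0 <= L by rewrite divr_ge0 ?enorm_ge0// ltW.
suff H t : 0 <= t <= 1 -> exists p, lifts f x v L t p by apply: H; rewrite ler01 lexx.
move: t; apply: (@real_induction R (fun t => exists p, lifts f x v L t p)).
- exists (fun=> x); split=> // [s|s s' _ ss' _].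
    by rewrite -eq_le => /eqP <-; rewrite scale0r addr0.
  by rewrite subrr enorm0 mulr_ge0// subr_ge0.
- move=> t /andP[t0 t1] Pt.
  have /choice[P PP] : forall s, exists p, 0 <= s < t -> lifts f x v L s p.
    move=> s; have [st|] := boolP (0 <= s < t); last by exists (fun=> x).
    by have [p] := Pt s st; exists p.
  have PE s s' : 0 <= s -> s <= s' -> s' < t -> P s' s = P s s.
    move=> s0 ss' s't; have st := le_lt_trans ss' s't.
    apply: (lifts_unique f x v L s) => //; rewrite ?s0 ?lexx ?(ltW (lt_le_trans st t1))//.
      have [|] := PP s'; first by rewrite (le_trans s0).
      move=> P0 fP LP; split=> // [r /andP[r0 rs]|r r' r0 rr' r's].
        by apply: fP; rewrite r0 (le_trans rs).
      by apply: LP => //; exact: le_trans ss'.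
    by apply: PP; rewrite s0.
  pose p s := P s s.
  have pL s s' : 0 <= s -> s <= s' -> s' < t -> enorm (p s' - p s) <= L * (s' - s).
    move=> s0 ss' s't; rewrite /p -(PE s s')//.
    have [|_ _] := PP s'; first by rewrite (le_trans s0).
    by apply.
  have p0 : p 0 = x by have [|] := PP 0; first by rewrite lexx.
  have fp s : 0 <= s < t -> f (p s) = f x + s *: v.
    move=> st; have [_ fP _] := PP s st; apply: fP.
    by case/andP: st => ->; rewrite lexx.
  have [||z _ zP] := compact_near _
      (fun e y => exists s, [/\ 0 <= s, t - e < s, s < t & y = p s]) (compact_cball x L).
  + move=> e e' y ee' [s [s0 es st ->]]; exists s; split=> //.
    by apply: le_lt_trans es; rewrite lerD2l lerN2.
  + move=> e e0; pose s := Num.max 0 (t - e / 2).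
    have s0 : 0 <= s by rewrite le_max lexx.
    have st : s < t by rewrite gt_max t0 /=; lra.
    exists (p s); last by exists s; split=> //; rewrite lt_max; apply/orP; right; lra.
    rewrite /= -p0; apply: le_trans (pL _ _ _ s0 st) _ => //.
    by rewrite subr0 ler_piMr//; lra.
  have zL s : 0 <= s -> s < t -> enorm (z - p s) <= L * (t - s).
    move=> s0 st; apply/ler_addgt0Pr => e e0.
    have m0 : 0 < Num.min e (t - s) by rewrite lt_min e0 subr_gt0.
    have [y _ [zs [s' [s'0 ms' s't yE]]]] := zP _ m0.
    move: zs; rewrite yE lt_min => /andP[zs _].
    have ss' : s <= s'.
      have : Num.min e (t - s) <= t - s by rewrite ge_min lexx orbT.
      by lra.
    have := enormB z (p s') (p s); rewrite (enormBC z (p s')).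
    have := pL s s' s0 ss' s't; have : L * (s' - s) <= L * (t - s).
      by rewrite ler_wpM2l//; lra.
    lra.
  have fz : f z = f x + t *: v.
    apply/eqP; rewrite -subr_eq0; apply/eqP/enorm_eq0/le_anti.
    rewrite enorm_ge0 andbT; apply/ler_addgt0Pr => e e0; rewrite add0r.
    have e20 : 0 < e / 2 by exact: divr_gt0.
    have [d d0 fd] := proj1 (continuous_enormP f) fc z _ e20.
    have v1 : 0 < enorm v + 1 by rewrite ltr_wpDl ?enorm_ge0.
    pose m := Num.min d (e / 2 / (enorm v + 1)).
    have m0 : 0 < m by rewrite lt_min d0 divr_gt0.
    have [md me] : m <= d /\ m <= e / 2 / (enorm v + 1).
      by rewrite !ge_min !lexx orbT.
    have [y _ [ys [s [s0 ms st yE]]]] := zP m m0.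
    move: ys; rewrite yE => /lt_le_trans /(_ md) /fd; rewrite fp ?s0//.
    move: me; rewrite ler_pdivlMr// => me.
    have : enorm (s *: v - t *: v) <= e / 2.
      rewrite -scalerBl enormZ ltr0_norm ?subr_lt0// opprB.
      apply: le_trans me; apply: ler_pM; rewrite ?enorm_ge0//; lra.
    have := enormB (f z) (f x + s *: v) (f x + t *: v).
    rewrite opprD addrACA subrr add0r (enormBC (f z) (f x + s *: v)); lra.
  exists (fun s => if s < t then p s else z); split.
  + by rewrite t0.
  + move=> s /andP[s0 st]; case: ltP => [s_lt|ts]; first by rewrite fp// s0.
    by rewrite fz; congr (_ + _ *: _); apply/le_anti; rewrite ts st.
  + move=> s s' s0 ss'; rewrite le_eqVlt => /orP[/eqP s'E|s't].
      rewrite s'E ltxx; case: ltP => [st|ts]; first exact: zL.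
      by rewrite subrr enorm0 mulr_ge0// subr_ge0 -s'E.
    by rewrite s't (le_lt_trans ss' s't); exact: pL.
- move=> t /andP[t0 t1] [p [p0 fp pL]].
  have fpt : f (p t) = f x + t *: v by apply: fp; rewrite t0 lexx.
  have [|r r0 fr] := fa (p t).
    by rewrite fpt addrAC subrr add0r enormZ ger0_norm// ler_piMl ?enorm_ge0 ?ltW.
  have [d d0 fd] := fo (p t) r r0.
  have v1 : 0 < enorm v + 1 by rewrite ltr_wpDl ?enorm_ge0.
  have /choice[q qP] : forall s, exists z, `|s - t| < d / (enorm v + 1) ->
      eball (p t) r z /\ f z = f x + s *: v.
    move=> s; have [st|] := boolP (`|s - t| < d / (enorm v + 1)); last by exists x.
    have [|z zr fz] := fd (f x + s *: v); last by exists z.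
    rewrite fpt opprD addrACA subrr add0r -scalerBl enormZ.
    move: st; rewrite ltr_pdivlMr//; apply: le_lt_trans.
    by rewrite ler_wpM2l// lerDl.
  exists (d / (enorm v + 1)); first exact: divr_gt0.
  move=> s /andP[ts std] s1.
  have qd s' : t <= s' <= s -> `|s' - t| < d / (enorm v + 1).
    by move=> /andP[ts' s's]; rewrite ger0_norm ?subr_ge0//; lra.
  have qL s1' s2' : t <= s1' -> s1' <= s2' -> s2' <= s ->
      enorm (q s2' - q s1') <= L * (s2' - s1').
    move=> ts1 s12 s2s.
    have [|q1 fq1] := qP s1' (qd _ _); first by rewrite ts1 (le_trans s12).
    have [|q2 fq2] := qP s2' (qd _ _); first by rewrite s2s (le_trans ts1).
    have := fr _ _ q2 q1; rewrite fq1 fq2 opprD addrACA subrr add0r -scalerBl enormZ.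
    rewrite ger0_norm ?subr_ge0// mulrC -ler_pdivlMr// => /le_trans; apply.
    by rewrite /L [leRHS]mulrC mulrA.
  have qt : q t = p t.
    have [|qtr fqt] := qP t (qd _ _); first by rewrite lexx ltW.
    apply: (expanding_at_inj f a (p t) r) => //; last by rewrite fqt fpt.
    exact: eball_center.
  exists (fun s' => if s' <= t then p s' else q s'); split.
  + by rewrite t0.
  + move=> s' /andP[s'0 s's]; case: leP => [s't|ts']; first by rewrite fp// s'0.
    by have [|_ ->] := qP s' (qd _ _); first by rewrite s's ltW.
  + move=> s1' s2' s10 s12 s2s; case: (leP s2' t) => [s2t|ts2].
      by rewrite (le_trans s12 s2t); exact: pL.
    case: (leP s1' t) => [s1t|ts1]; last by apply: qL => //; exact: ltW.
    have := enormB (q s2') (p t) (p s1'); rewrite -{1}qt.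
    have := qL t s2' (lexx t) (ltW ts2) s2s; have := pL s1' t s10 s1t (lexx t).
    lra.
Qed.

Lemma homeomorphism_of_lifting f : continuous f -> locally_open f ->
  (forall y, exists c r, [/\ 0 < c, 0 < r & expanding_at f c y r]) ->
  (forall x e, exists2 a, 0 < a & forall y, enorm (f y - f x) <= e ->
    exists2 r, 0 < r & expanding_at f a y r) ->
  global_homeomorphism f.
Proof.
move=> fc fo floc fa; pose x0 : 'cV[R]_n := 0.
have /choice[P PP] : forall y, exists pL : (R -> 'cV[R]_n) * R,
    0 <= pL.2 /\ lifts f x0 (y - f x0) pL.2 1 pL.1.
  move=> y; have [a a0 fay] := fa x0 (enorm (y - f x0)).
  have [p pl] := lifts_exist f x0 (y - f x0) a fc fo a0 floc fay.
  by exists (p, enorm (y - f x0) / a); split; rewrite //= divr_ge0 ?enorm_ge0// ltW.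
pose g y := (P y).1 1.
have fg y : f (g y) = y.
  have [_ [_ fp _]] := PP y; rewrite /g fp ?ler01 ?lexx//.
  by rewrite scale1r addrC subrK.
have lip_g y : exists2 c, 0 < c & forall y' v L q, 0 <= L -> lifts f x0 v L 1 q ->
    v = y' - f x0 -> enorm (y - y') < c * c ->
    enorm (g y - q 1) <= enorm (y - y') / c.
  have [L0 pl] := PP y.
  have [c c0 fc'] := expanding_uniform f _ (compact_cball x0 (P y).2) floc.
  exists c => // y' v L q L'0 ql vE yy'.
  have vv : y - f x0 - v = y - y' by rewrite vE opprB addrA subrK.
  have h01 : 0 <= (1 : R) <= 1 by rewrite ler01 lexx.
  have := lifts_compare f x0 _ v _ L 1 _ q c L0 L'0 h01 c0 pl ql _ _ 1 h01.
  rewrite vv; apply=> // s s01; apply: fc' => /=; case: pl => p0 _ pL.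
  rewrite -{1}p0; case/andP: (s01) => s0 s1; apply: le_trans (pL 0 s _ s0 s1) _ => //.
  by rewrite subr0 ler_piMr.
have gc : continuous g.
  apply/continuous_enormP => y e e0; have [c c0 gy] := lip_g y.
  exists (Num.min (c * c) (c * e)) => [|y']; first by rewrite lt_min !mulr_gt0.
  rewrite lt_min => /andP[yc ye]; have [L0 pl] := PP y'.
  have := gy y' _ _ _ L0 pl erefl; rewrite (enormBC y y') => /(_ yc).
  rewrite enormBC => /le_lt_trans; apply.
  by rewrite ltr_pdivrMr// mulrC.
have gx0 : g (f x0) = x0.
  have [c c0 gy] := lip_g (f x0).
  have xl : lifts f x0 0 0 1 (fun=> x0).
    split=> // [s _|s s' _ _ _]; first by rewrite scaler0 addr0.
    by rewrite subrr enorm0 mul0r.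
  have := gy (f x0) 0 0 _ (lexx 0) xl; rewrite subrr enorm0 mul0r => /(_ erefl).
  move=> h; apply/eqP; rewrite -subr_eq0; apply/eqP/enorm_eq0/le_anti.
  by rewrite enorm_ge0 h// mulr_gt0.
have gfc := proj1 (continuous_enormP (g \o f)) (fun x => continuous_comp (@fc x) (@gc (f x))).
exists g; split=> // x.
pose xi s := s *: x.
have xiB s s' : enorm (xi s' - xi s) <= `|s' - s| * (enorm x + 1).
  by rewrite /xi -scalerBl enormZ ler_wpM2l// lerDl.
have x1 : 0 < enorm x + 1 by rewrite ltr_wpDl ?enorm_ge0.
suff H s : 0 <= s <= 1 -> g (f (xi s)) = xi s.
  by have := H 1; rewrite /xi scale1r; apply; rewrite ler01 lexx.
move: s; apply: (@real_induction R (fun s => g (f (xi s)) = xi s)).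
- by rewrite /xi scale0r.
- move=> s /andP[s0 s1] Ps; apply/eqP; rewrite -subr_eq0; apply/eqP/enorm_eq0/le_anti.
  rewrite enorm_ge0 andbT; apply/ler_addgt0Pr => e e0; rewrite add0r.
  have e20 : 0 < e / 2 by exact: divr_gt0.
  have [d d0 gd] := gfc (xi s) _ e20.
  pose m := Num.min s (Num.min d (e / 2) / 2 / (enorm x + 1)).
  have m0 : 0 < m by rewrite lt_min s0 !divr_gt0// lt_min d0.
  have [ms mx] : m <= s /\ m <= Num.min d (e / 2) / 2 / (enorm x + 1).
    by rewrite !ge_min !lexx orbT.
  have := xiB s (s - m); rewrite (addrAC s) subrr add0r normrN gtr0_norm// => xm.
  have [dd de] : Num.min d (e / 2) <= d /\ Num.min d (e / 2) <= e / 2.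
    by rewrite !ge_min !lexx orbT.
  have dm : 0 < Num.min d (e / 2) by rewrite lt_min d0.
  move: mx; rewrite ler_pdivlMr// => mx.
  have /gd /= : enorm (xi (s - m) - xi s) < d by lra.
  rewrite Ps ?subr_ge0 ?ms ?ltrBlDr ?ltrDl// => gm.
  have := enormB (g (f (xi s))) (xi (s - m)) (xi s).
  rewrite (enormBC (g (f (xi s))) (xi (s - m))); lra.
- move=> s _ Ps; have [c [r [c0 r0 fr]]] := floc (xi s).
  have [d d0 gd] := gfc (xi s) r r0.
  have m0 : 0 < Num.min d r by rewrite lt_min d0.
  exists (Num.min d r / (enorm x + 1)); first exact: divr_gt0.
  move=> s' /andP[ss' s'd] _.
  have : enorm (xi s' - xi s) < Num.min d r.
    apply: le_lt_trans (xiB _ _) _; rewrite -ltr_pdivlMr//.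
    by rewrite gtr0_norm ?subr_gt0// ltrBlDl.
  rewrite lt_min => /andP[/gd /=]; rewrite Ps => gs' xs'.
  exact: (expanding_at_inj f c (xi s) r _ _ c0 fr gs' xs' (fg _)).
Qed.

End PathLifting.

Lemma ereal_gt0_real {R : realType} (x : \bar R) : (0 < x)%E ->
  exists2 a : R, 0 < a & (a%:E < x)%E.
Proof.
case: x => [x|_|//]; last by exists 1 => //; rewrite ltry.
by rewrite lte_fin => x0; exists (x / 2); [exact: divr_gt0|rewrite lte_fin; lra].
Qed.

Section RegularMaps.
Context {R : realType} {n : nat}.
Variables (f : 'cV[R]_n -> 'cV[R]_n) (Jf : 'cV[R]_n -> set 'M[R]_n).
Hypotheses (f_cont : continuous f) (Jf_pseudo : pseudo_Jacobian_map f Jf).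
Hypothesis Jf_usc : forall x, usc_at Jf x.

Lemma regular_expanding x a : 0 < a -> (a%:E < regularity_index Jf x)%E ->
  exists2 r, 0 < r & expanding_at f a x r.
Proof.
move=> a0 ax.
have [r [C [r0 cC Ca _ fC]]] := regular_local_hull _ _ _ _ f_cont Jf_pseudo (Jf_usc x) ax.
by exists r => // y z; exact: (increments_expanding C _ f a cC Ca a0 fC).
Qed.

Lemma regular_locally_open : (forall x, (0 < regularity_index Jf x)%E) -> locally_open f.
Proof.
move=> reg x r r0; have [a a0 ax] := ereal_gt0_real _ (reg x).
have [r1 [C [r10 cC Ca _ fC]]] := regular_local_hull _ _ _ _ f_cont Jf_pseudo (Jf_usc x) ax.
pose s := Num.min r r1 / 2.
have m0 : 0 < Num.min r r1 by rewrite lt_min r0.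
have [mr mr1] : Num.min r r1 <= r /\ Num.min r r1 <= r1 by rewrite !ge_min !lexx orbT.
have sr1 : 0 < s < r1 by rewrite /s; lra.
exists (a * s / 2) => [|y yx].
  by case/andP: sr1 => s0 _; rewrite divr_gt0 ?mulr_gt0.
have [z zs fz] := increments_covering f C x s r1 a sr1 a0 cC Ca f_cont fC y yx.
by exists z => //; apply: le_lt_trans zs _; rewrite /s; lra.
Qed.

Lemma regularity_index_compact (K : set 'cV[R]_n) :
  (forall x, (0 < regularity_index Jf x)%E) -> compact K ->
  exists2 a : R, 0 < a & forall x, K x -> (a%:E < regularity_index Jf x)%E.
Proof.
move=> reg cK; apply: contrapT => na.
have [||x Kx xP] := compact_near K (fun e x => ~ (e%:E < regularity_index Jf x)%E) cK.
- by move=> e e' x ee' + fe'; apply; apply: le_lt_trans fe'; rewrite lee_fin.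
- move=> e e0; apply: contrapT => ne; apply: na; exists e => // x Kx.
  by apply: contrapT => ?; apply: ne; exists x.
have [a a0 ax] := ereal_gt0_real _ (reg x).
have [r [C [r0 cC Ca JC _]]] := regular_local_hull _ _ _ _ f_cont Jf_pseudo (Jf_usc x) ax.
have m0 : 0 < Num.min r (a / 2) by rewrite lt_min r0 divr_gt0.
have [y _ [yx]] := xP _ m0; apply.
apply: (@lt_le_trans _ _ a%:E).
  by rewrite lte_fin gt_min; apply/orP; right; lra.
apply: regularity_index_ge cC Ca (JC y _); apply: lt_le_trans yx _.
by rewrite ge_min lexx.
Qed.

End RegularMaps.

Theorem theorem4p2 (R : realType) (n : nat)
    (f : 'cV[R]_n -> 'cV[R]_n) (Jf : 'cV[R]_n -> set 'M[R]_n)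
    (f_cont : continuous f)
    (Jf_pseudo : pseudo_Jacobian_map f Jf)
    (Jf_usc : forall x : 'cV[R]_n, usc_at Jf x)
    (f_regular : forall x : 'cV[R]_n, (0 < regularity_index Jf x)%E) :
  global_homeomorphism f <->
  (forall K : set 'cV[R]_n, compact K ->
    exists2 alphaK : R, 0 < alphaK &
      forall x : 'cV[R]_n, (f @^-1` K) x ->
        (alphaK%:E < regularity_index Jf x)%E).
Proof.
split=> [[g [fK gK _ gc]] K cK|fb].
  have cgK : compact (g @` K).
    by apply: continuous_compact cK; exact: continuous_subspaceT.
  have [a a0 aK] := regularity_index_compact f Jf f_cont Jf_pseudo Jf_usc _ f_regular cgK.
  by exists a => // x Kx; apply: aK; exists (f x) => //; exact: fK.
apply: homeomorphism_of_lifting => //.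
- exact: regular_locally_open f_regular.
- move=> x; have [a a0 ax] := ereal_gt0_real _ (f_regular x).
  have [r r0 fr] := regular_expanding f Jf f_cont Jf_pseudo Jf_usc x a a0 ax.
  by exists a, r.
- move=> x e; have [a a0 aK] := fb _ (compact_cball (f x) e).
  by exists a => // y yx; apply: (regular_expanding f Jf) => //; exact: aK.
Qed.
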